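(* The assignment $\mathsf{C} \mapsto \mathcal{E}_h^{(2)}(\mathsf{C})$, equipped with the canonical fully faithful embeddings $\mathsf{C} \to \mathcal{E}_h^{(2)}(\mathsf{C})$ (the KZ-machine of equivalence 2-groupoids), is a KZ-doctrine on the 2-category $\mathfrak{Lex}$.
   Context: $\mathfrak{Lex}$ is the strict 2-category of lex categories (locally small categories with finite limits, whose set of objects is contained in a fixed universe), lex functors (functors preserving finite limits) and natural transformations. Kan extensions. In a 2-category (i.e. bicategory), a left Kan extension of $f:X\to Z$ along $p:X\to Y$ is a morphism $p_!(f):Y\to Z$ with a 2-morphism $f\to p_!(f)\circ p$ such that for every $g:Y\to Z$ and every 2-morphism $f\to g\circ p$ there is a unique 2-morphism $p_!(f)\to g$ through which it factors as $f\to p_!(f)\circ p\to g\circ p$. KZ-machines. A KZ-machine $P$ on a 2-category $\mathfrak{C}$ is the data, for every object $X$, of an object $P(X)$ and a morphism $i_P(X):X\to P(X)$ such that: for every $f:X\to Y$, the morphism $i_P(Y)\circ f$ has a left Kan extension $P(f)$ along $i_P(X)$ and the 2-morphism $i_P(Y)\circ f\to P(f)\circ i_P(X)$ is invertible; and the canonical 2-morphisms $P(g\circ f)\to P(g)\circ P(f)$ and $P(\mathrm{Id}_X)\to \mathrm{Id}_{P(X)}$ are invertible. An object $Y$ is $P$-cocomplete (a $P$-algebra) if every $f:X\to Y$ has a left Kan extension $\overline{f}$ along $i_P(X)$ with $f\to\overline{f}\circ i_P(X)$ invertible, and for every $g:X'\to X$ the canonical 2-morphism $\overline{f\circ g}\to\overline{f}\circ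 P(g)$ is invertible. Put $m_P(Y)=\overline{\mathrm{Id}_Y}$. A morphism $f:X\to Y$ between $P$-cocomplete objects is $P$-linear if the canonical 2-morphism $\overline{f}\to f\circ m_P(X)$ is invertible. A KZ-doctrine is a KZ-machine $M$ such that $M(X)$ is $M$-cocomplete for every $X$ and $M(f)$ is $M$-linear for every $f$. Equivalence 2-groupoids. Let $\mathsf{C}$ be a lex category. An equivalence 2-groupoid $A$ in $\mathsf{C}$ consists of objects $A_0,A_1$ and morphisms $d_0,d_1:A_1\to A_0$, $\sigma:A_0\to A_1$ with $d_0\sigma=d_1\sigma=\mathrm{Id}$, such that the associated 1-coskeletal simplicial object is Kan; equivalently, there exist (unspecified) morphisms $c:A_1\times_{A_0}A_1\to A_1$ (pullback of $d_1$ on the first factor and $d_0$ on the second) with $d_0c=d_0\pi_1$, $d_1c=d_1\pi_2$, and $\tau:A_1\to A_1$ with $d_0\tau=d_1$, $d_1\tau=d_0$. The category $\mathcal{E}^{(2)}(\mathsf{C})$ has equivalence 2-groupoids as objects; a morphism $A\to B$ is a pair $f_0:A_0\to B_0$, $f_1:A_1\to B_1$ with $(d_0,d_1)\circ f_1=(f_0\times f_0)\circ(d_0,d_1)$ (no compatibility with $\sigma$ is required). Two morphisms $f,g:A\to B$ are homotopic if $(f_0,g_0):A_0\to B_0\times B_0$ factors through $(d_0,d_1):B_1\to B_0\times B_0$. This is an equivalence relation compatible with composition, and $\mathcal{E}_h^{(2)}(\mathsf{C})$ is the quotient category of $\mathcal{E}^{(2)}(\mathsf{C})$ identifying homotopic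 morphisms. The embedding $\mathsf{C}\to\mathcal{E}_h^{(2)}(\mathsf{C})$ sends $X$ to $(X,X)$ with identity structure maps. A lex functor $F:\mathsf{C}\to\mathsf{D}$ induces $\mathcal{E}_h^{(2)}(F):(A_0,A_1)\mapsto(F(A_0),F(A_1))$. *)

(* Defs.v *)
(* Written against the Rocq standard library, with Leibniz equality on hom-sets.

   [category] is universe monomorphic on purpose: its two universes, bounding
   objects and hom-sets, are fixed once and for all.  The only constraint put on
   them below is that hom-sets live no higher than sets of objects, so categories
   that are locally small but large are allowed. *)
From Stdlib Require Import List FinFun.
From Stdlib Require Import FunctionalExtensionality PropExtensionality.
From Stdlib Require Import ProofIrrelevance ClassicalEpsilon.

Set Implicit Arguments.
Unset Strict Implicit.
Unset Printing Implicit Defensive.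

Declare Scope cat_scope.
Open Scope cat_scope.

Record category := Category {
  obj :> Type;
  hom : obj -> obj -> Type;
  idm : forall x, hom x x;
  comp : forall x y z, hom y z -> hom x y -> hom x z;
  comp_idl : forall x y (f : hom x y), comp (idm y) f = f;
  comp_idr : forall x y (f : hom x y), comp f (idm x) = f;
  comp_assoc : forall x y z w (h : hom z w) (g : hom y z) (f : hom x y),
    comp h (comp g f) = comp (comp h g) f
}.

Arguments hom {c} x y.
Arguments idm {c} x.
Arguments comp {c x y z} g f.
Notation "g ∘ f" := (comp g f) (at level 40, left associativity) : cat_scope.

Record functor (C D : category) := Functor {
  fobj :> C -> D;
  fmap : forall x y, hom x y -> hom (fobj x) (fobj y);
  fmap_id : forall x, fmap (idm x) = idm (fobj x);
  fmap_comp : forall x y z (g : hom y z) (f : hom x y),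
    fmap (g ∘ f) = fmap g ∘ fmap f
}.

Arguments fmap {C D} F {x y} f : rename.

Definition functor_id (C : category) : functor C C :=
  @Functor C C (fun x => x) (fun x y f => f)
    (fun x => eq_refl) (fun x y z g f => eq_refl).

Definition functor_comp (C D E : category) (G : functor D E) (F : functor C D) :
  functor C E.
Proof.
refine (@Functor C E (fun x => G (F x)) (fun x y f => fmap G (fmap F f)) _ _).
- intro x. rewrite fmap_id. apply fmap_id.
- intros x y z g f. rewrite fmap_comp. apply fmap_comp.
Defined.

Definition fully_faithful (C D : category) (F : functor C D) : Prop :=
  forall (x y : C) (g : hom (F x) (F y)), exists! f : hom x y, fmap F f = g.

Record nattrans (C D : category) (F G : functor C D) := Nattrans {
  ncomp :> forall x, hom (F x) (G x);
  natural : forall x y (u : hom x y), fmap G u ∘ ncomp x = ncomp y ∘ fmap F u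
}.

Lemma nattrans_ext (C D : category) (F G : functor C D) (a b : nattrans F G) :
  (forall x, a x = b x) -> a = b.
Proof.
destruct a as [a na], b as [b nb]; simpl; intro e.
assert (ab : a = b) by (apply functional_extensionality_dep; exact e).
subst b. f_equal. apply proof_irrelevance.
Qed.

Section Limits.
Variables (J C : category) (D : functor J C).

Definition is_cone (x : C) (l : forall j, hom x (D j)) : Prop :=
  forall j k (u : hom j k), fmap D u ∘ l j = l k.

Definition is_limit (x : C) (l : forall j, hom x (D j)) : Prop :=
  is_cone l /\
  forall (y : C) (m : forall j, hom y (D j)), is_cone m ->
    exists! u : hom y x, forall j, l j ∘ u = m j.

End Limits.

Definition finite_category (J : category) : Prop :=
  Finite J /\ forall j k : J, Finite (hom j k).

Definition has_finite_limits (C : category) : Prop :=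
  forall J : category, finite_category J ->
  forall D : functor J C, exists (x : C) (l : forall j, hom x (D j)), is_limit l.

Definition preserves_finite_limits (C C' : category) (F : functor C C') : Prop :=
  forall J : category, finite_category J ->
  forall (D : functor J C) (x : C) (l : forall j, hom x (D j)),
    is_limit l -> is_limit (D := functor_comp F D) (fun j => fmap F (l j)).

Definition is_pullback (C : category) (a b c : C) (f : hom a c) (g : hom b c)
    (p : C) (p1 : hom p a) (p2 : hom p b) : Prop :=
  f ∘ p1 = g ∘ p2 /\
  forall (x : C) (u : hom x a) (v : hom x b), f ∘ u = g ∘ v ->
    exists! w : hom x p, p1 ∘ w = u /\ p2 ∘ w = v.

Section Cospan.

Inductive cospan_obj := cospan_l | cospan_r | cospan_m.

Definition cospan_hom (x y : cospan_obj) : Type :=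
  match x, y with
  | cospan_l, cospan_l | cospan_r, cospan_r | cospan_m, cospan_m
  | cospan_l, cospan_m | cospan_r, cospan_m => unit
  | _, _ => Empty_set
  end.

Definition cospan : category.
Proof.
assert (i : forall x, cospan_hom x x) by (intros []; exact tt).
assert (c : forall x y z, cospan_hom y z -> cospan_hom x y -> cospan_hom x z)
  by (intros [] [] [] g f; exact tt || exact g || exact f).
assert (u : forall x y (f g : cospan_hom x y), f = g)
  by (intros [] [] [] []; reflexivity).
exact (@Category cospan_obj cospan_hom i c
  (fun _ _ _ => u _ _ _ _) (fun _ _ _ => u _ _ _ _)
  (fun _ _ _ _ _ _ _ => u _ _ _ _)).
Defined.

Lemma cospan_finite : finite_category cospan.
Proof.
split.
- exists (cospan_l :: cospan_r :: cospan_m :: nil). intros []; simpl; auto.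
- intros [] []; (exists (tt :: nil); intros []; simpl; auto; fail)
    || (exists nil; intros []).
Qed.

Variables (C : category) (a b c : C) (f : hom a c) (g : hom b c).

Definition cospan_functor : functor cospan C.
Proof.
set (o := fun x : cospan =>
  match x return C with cospan_l => a | cospan_r => b | cospan_m => c end).
refine (@Functor cospan C o
  (fun x y => match x, y return cospan_hom x y -> hom (o x) (o y) with
     | cospan_l, cospan_l | cospan_r, cospan_r | cospan_m, cospan_m =>
         fun _ => idm _
     | cospan_l, cospan_m => fun _ => f
     | cospan_r, cospan_m => fun _ => g
     | _, _ => fun e => match e with end
     end) _ _).
- intros []; reflexivity.
- intros [] [] [] u v; simpl in *;
    repeat match goal with e : Empty_set |- _ => destruct e end;
    rewrite ?comp_idl, ?comp_idr; reflexivity.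
Defined.

End Cospan.

Lemma preserves_pullback (C C' : category) (F : functor C C') :
  preserves_finite_limits F ->
  forall (a b c : C) (f : hom a c) (g : hom b c) (p : C) (p1 : hom p a)
    (p2 : hom p b),
  is_pullback f g p1 p2 ->
  is_pullback (fmap F f) (fmap F g) (fmap F p1) (fmap F p2).
Proof.
intros HF a b c f g p p1 p2 [e univ].
set (D := cospan_functor f g).
set (l := fun j : cospan => match j return hom p (D j) with
  | cospan_l => p1 | cospan_r => p2 | cospan_m => f ∘ p1 end).
assert (Hl : is_limit l).
{ split.
  - intros [] [] u; try destruct u; simpl; rewrite ?comp_idl; auto.
  - intros y m Hm.
    assert (mf : f ∘ m cospan_l = m cospan_m) by exact (Hm cospan_l cospan_m tt).
    assert (mg : g ∘ m cospan_r = m cospan_m) by exact (Hm cospan_r cospan_m tt).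
    destruct (univ y (m cospan_l) (m cospan_r)) as [w [[w1 w2] wu]].
    { exact (eq_trans mf (eq_sym mg)). }
    exists w. split.
    + intros []; simpl; auto. rewrite <- comp_assoc, w1. exact mf.
    + intros w' H. apply wu. split; [exact (H cospan_l)|exact (H cospan_r)]. }
destruct (HF cospan cospan_finite D p l Hl) as [_ univF].
split.
- now rewrite <- !fmap_comp, e.
- intros x u v uv.
  set (m := fun j : cospan => match j return hom x (functor_comp F D j) with
    | cospan_l => u | cospan_r => v | cospan_m => fmap F f ∘ u end).
  destruct (univF x m) as [w [Hw wu]].
  { intros [] [] t; try destruct t; simpl; rewrite ?fmap_id, ?comp_idl; auto. }
  exists w. split.
  + split; [exact (Hw cospan_l)|exact (Hw cospan_r)].
  + intros w' [w1 w2]. apply wu. intros []; simpl; auto.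
    rewrite fmap_comp, <- comp_assoc, w1. reflexivity.
Qed.

Record bicategory := Bicategory {
  bob :> Type;
  mor : bob -> bob -> Type;
  cell : forall X Y, mor X Y -> mor X Y -> Type;
  mid : forall X, mor X X;
  mcomp : forall X Y Z, mor Y Z -> mor X Y -> mor X Z;
  cid : forall X Y (f : mor X Y), cell f f;
  vcomp : forall X Y (f g h : mor X Y), cell g h -> cell f g -> cell f h;
  hcomp : forall X Y Z (g g' : mor Y Z) (f f' : mor X Y),
    cell g g' -> cell f f' -> cell (mcomp g f) (mcomp g' f');
  asc : forall X Y Z W (h : mor Z W) (g : mor Y Z) (f : mor X Y),
    cell (mcomp h (mcomp g f)) (mcomp (mcomp h g) f);
  asc_inv : forall X Y Z W (h : mor Z W) (g : mor Y Z) (f : mor X Y),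
    cell (mcomp (mcomp h g) f) (mcomp h (mcomp g f));
  lun : forall X Y (f : mor X Y), cell (mcomp (mid Y) f) f;
  lun_inv : forall X Y (f : mor X Y), cell f (mcomp (mid Y) f);
  run : forall X Y (f : mor X Y), cell (mcomp f (mid X)) f;
  run_inv : forall X Y (f : mor X Y), cell f (mcomp f (mid X));
  vcomp_idl : forall X Y (f g : mor X Y) (a : cell f g), vcomp (cid g) a = a;
  vcomp_idr : forall X Y (f g : mor X Y) (a : cell f g), vcomp a (cid f) = a;
  vcomp_assoc : forall X Y (f g h k : mor X Y)
    (c : cell h k) (b : cell g h) (a : cell f g),
    vcomp c (vcomp b a) = vcomp (vcomp c b) a;
  hcomp_id : forall X Y Z (g : mor Y Z) (f : mor X Y),
    hcomp (cid g) (cid f) = cid (mcomp g f);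
  hcomp_vcomp : forall X Y Z (g g' g'' : mor Y Z) (f f' f'' : mor X Y)
    (b' : cell g' g'') (b : cell g g') (a' : cell f' f'') (a : cell f f'),
    hcomp (vcomp b' b) (vcomp a' a) = vcomp (hcomp b' a') (hcomp b a);
  ascK : forall X Y Z W (h : mor Z W) (g : mor Y Z) (f : mor X Y),
    vcomp (asc_inv h g f) (asc h g f) = cid _;
  asc_invK : forall X Y Z W (h : mor Z W) (g : mor Y Z) (f : mor X Y),
    vcomp (asc h g f) (asc_inv h g f) = cid _;
  lunK : forall X Y (f : mor X Y), vcomp (lun_inv f) (lun f) = cid _;
  lun_invK : forall X Y (f : mor X Y), vcomp (lun f) (lun_inv f) = cid _;
  runK : forall X Y (f : mor X Y), vcomp (run_inv f) (run f) = cid _;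
  run_invK : forall X Y (f : mor X Y), vcomp (run f) (run_inv f) = cid _;
  asc_natural : forall X Y Z W (h h' : mor Z W) (g g' : mor Y Z) (f f' : mor X Y)
    (c : cell h h') (b : cell g g') (a : cell f f'),
    vcomp (asc h' g' f') (hcomp c (hcomp b a)) =
    vcomp (hcomp (hcomp c b) a) (asc h g f);
  lun_natural : forall X Y (f f' : mor X Y) (a : cell f f'),
    vcomp (lun f') (hcomp (cid (mid Y)) a) = vcomp a (lun f);
  run_natural : forall X Y (f f' : mor X Y) (a : cell f f'),
    vcomp (run f') (hcomp a (cid (mid X))) = vcomp a (run f);
  triangle : forall X Y Z (g : mor Y Z) (f : mor X Y),
    vcomp (hcomp (run g) (cid f)) (asc g (mid Y) f) = hcomp (cid g) (lun f);
  pentagon : forall X Y Z W V (k : mor W V) (h : mor Z W) (g : mor Y Z)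
    (f : mor X Y),
    vcomp (asc (mcomp k h) g f) (asc k h (mcomp g f)) =
    vcomp (hcomp (asc k h g) (cid f))
      (vcomp (asc k (mcomp h g) f) (hcomp (cid k) (asc h g f)))
}.

Arguments mor {B} X Y : rename.
Arguments cell {B X Y} f g : rename.
Arguments mid {B} X : rename.
Arguments mcomp {B X Y Z} g f : rename.
Arguments cid {B X Y} f : rename.
Arguments vcomp {B X Y f g h} _ _ : rename.
Arguments hcomp {B X Y Z g g' f f'} _ _ : rename.
Arguments asc {B X Y Z W} h g f : rename.
Arguments asc_inv {B X Y Z W} h g f : rename.
Arguments lun {B X Y} f : rename.
Arguments lun_inv {B X Y} f : rename.
Arguments run {B X Y} f : rename.
Arguments run_inv {B X Y} f : rename.

Declare Scope bicat_scope.
Open Scope bicat_scope.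
Notation "f ⇒ g" := (cell f g) (at level 70) : bicat_scope.
Notation "g ⊙ f" := (mcomp g f) (at level 40, left associativity) : bicat_scope.
Notation "b • a" := (vcomp b a) (at level 50, left associativity) : bicat_scope.
Notation "g ◁ a" := (hcomp (cid g) a) (at level 38) : bicat_scope.
Notation "a ▷ f" := (hcomp a (cid f)) (at level 38) : bicat_scope.

Definition invertible (B : bicategory) (X Y : B) (f g : mor X Y) (a : f ⇒ g) :
  Prop := exists b : g ⇒ f, b • a = cid f /\ a • b = cid g.

Section Lan.
Variables (B : bicategory) (X Y Z : B).

Definition is_lan (p : mor X Y) (f : mor X Z) (l : mor Y Z) (u : f ⇒ l ⊙ p) :
  Prop :=
  forall (g : mor Y Z) (a : f ⇒ g ⊙ p), exists! b : l ⇒ g, a = (b ▷ p) • u.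

Record lan (p : mor X Y) (f : mor X Z) := Lan {
  lan_mor :> mor Y Z;
  lan_unit : f ⇒ lan_mor ⊙ p;
  lan_univ : is_lan lan_unit
}.

(* The 2-morphism [L ⇒ g] through which [a] factors is invertible. *)
Definition lan_desc_invertible (p : mor X Y) (f : mor X Z) (L : lan p f)
    (g : mor Y Z) (a : f ⇒ g ⊙ p) : Prop :=
  exists b : L ⇒ g, a = (b ▷ p) • lan_unit L /\ invertible b.

End Lan.

Record kz_data (B : bicategory) := KZData {
  kz_ob :> B -> B;
  kz_unit : forall X : B, mor X (kz_ob X)
}.

(* Left Kan extensions are determined up to a unique invertible 2-morphism, so
   no choice of them is made part of the data: below, [P(f)] ranges over all left
   Kan extensions [Pf] of [i_P(Y) ⊙ f] along [i_P(X)], and the extension of a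
   morphism [f] to a [P]-cocomplete object over all left Kan extensions [Lf] of
   [f] along [i_P(X)]. *)
Section KZ.
Variables (B : bicategory) (P : kz_data B).
Local Notation i := (kz_unit P).

Definition kz_lan (X Y : B) (f : mor X Y) := lan (i X) (i Y ⊙ f).

Definition is_kz_machine : Prop :=
  (forall (X Y : B) (f : mor X Y),
     exists Pf : kz_lan f, invertible (lan_unit Pf)) /\
  (forall (X Y Z : B) (g : mor Y Z) (f : mor X Y)
     (Pg : kz_lan g) (Pf : kz_lan f) (Pgf : kz_lan (g ⊙ f)),
     lan_desc_invertible Pgf
       (asc Pg Pf (i X) • (Pg ◁ lan_unit Pf) • asc_inv Pg (i Y) f •
        (lan_unit Pg ▷ f) • asc (i Z) g f)) /\
  (forall (X : B) (Pid : kz_lan (mid X)),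
     lan_desc_invertible Pid (lun_inv (i X) • run (i X))).

Definition kz_cocomplete (Y : B) : Prop :=
  (forall (X : B) (f : mor X Y),
     exists Lf : lan (i X) f, invertible (lan_unit Lf)) /\
  (forall (X' X : B) (g : mor X' X) (f : mor X Y)
     (Pg : kz_lan g) (Lf : lan (i X) f) (Lfg : lan (i X') (f ⊙ g)),
     lan_desc_invertible Lfg
       (asc Lf Pg (i X') • (Lf ◁ lan_unit Pg) • asc_inv Lf (i X) g •
        (lan_unit Lf ▷ g))).

(* [m] is the structure map [m_P(X)] of the [P]-cocomplete object [X]. *)
Definition kz_linear (X Y : B) (f : mor X Y) : Prop :=
  forall (m : lan (i X) (mid X)) (Lf : lan (i X) f),
    lan_desc_invertible Lf (asc f m (i X) • (f ◁ lan_unit m) • run_inv f).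

Definition is_kz_doctrine : Prop :=
  is_kz_machine /\
  (forall X : B, kz_cocomplete (P X)) /\
  (forall (X Y : B) (f : mor X Y) (Pf : kz_lan f), kz_linear Pf).

End KZ.

Record lexcat := LexCat {
  lex_cat :> category;
  lex_limits : has_finite_limits lex_cat
}.

Record lexfun (C D : category) := LexFun {
  lex_functor :> functor C D;
  lex_preserves : preserves_finite_limits lex_functor
}.

Definition lexfun_id (C : category) : lexfun C C :=
  @LexFun C C (functor_id C) (fun J HJ D x l Hl => Hl).

Definition lexfun_comp (C D E : category) (G : lexfun D E) (F : lexfun C D) :
  lexfun C E :=
  @LexFun C E (functor_comp G F) (fun J HJ K x l Hl =>
    lex_preserves G HJ (lex_preserves F HJ Hl)).

Definition nat_id (C D : category) (F : functor C D) : nattrans F F.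
Proof.
refine (@Nattrans C D F F (fun x => idm (F x)) _).
intros x y u. now rewrite comp_idl, comp_idr.
Defined.

Definition nat_vcomp (C D : category) (F G H : functor C D)
    (b : nattrans G H) (a : nattrans F G) : nattrans F H.
Proof.
refine (@Nattrans C D F H (fun x => b x ∘ a x) _).
intros x y u. now rewrite comp_assoc, natural, <- comp_assoc, natural, comp_assoc.
Defined.

Definition nat_hcomp (C D E : category) (G G' : functor D E) (F F' : functor C D)
    (b : nattrans G G') (a : nattrans F F') :
  nattrans (functor_comp G F) (functor_comp G' F').
Proof.
refine (@Nattrans C E (functor_comp G F) (functor_comp G' F')
  (fun x => b (F' x) ∘ fmap G (a x)) _).
intros x y u. simpl.
now rewrite comp_assoc, natural, <- !comp_assoc, <- !fmap_comp, natural.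
Defined.

(* The 2-category is strict: source and target of the following agree on objects
   and on morphisms by conversion, and all the components are identities. *)
Definition nat_asc (A B C D : category) (H : functor C D) (G : functor B C)
    (F : functor A B) :
  nattrans (functor_comp H (functor_comp G F)) (functor_comp (functor_comp H G) F) :=
  @Nattrans A D (functor_comp H (functor_comp G F)) (functor_comp (functor_comp H G) F)
    (fun x => idm (H (G (F x)))) (natural (nat_id (functor_comp H (functor_comp G F)))).

Definition nat_asc_inv (A B C D : category) (H : functor C D) (G : functor B C)
    (F : functor A B) :
  nattrans (functor_comp (functor_comp H G) F) (functor_comp H (functor_comp G F)) :=
  @Nattrans A D (functor_comp (functor_comp H G) F) (functor_comp H (functor_comp G F))
    (fun x => idm (H (G (F x)))) (natural (nat_id (functor_comp (functor_comp H G) F))).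

Definition nat_lun (C D : category) (F : functor C D) :
  nattrans (functor_comp (functor_id D) F) F :=
  @Nattrans C D (functor_comp (functor_id D) F) F
    (fun x => idm (F x)) (natural (nat_id (functor_comp (functor_id D) F))).

Definition nat_lun_inv (C D : category) (F : functor C D) :
  nattrans F (functor_comp (functor_id D) F) :=
  @Nattrans C D F (functor_comp (functor_id D) F)
    (fun x => idm (F x)) (natural (nat_id F)).

Definition nat_run (C D : category) (F : functor C D) :
  nattrans (functor_comp F (functor_id C)) F :=
  @Nattrans C D (functor_comp F (functor_id C)) F
    (fun x => idm (F x)) (natural (nat_id (functor_comp F (functor_id C)))).

Definition nat_run_inv (C D : category) (F : functor C D) :
  nattrans F (functor_comp F (functor_id C)) :=
  @Nattrans C D F (functor_comp F (functor_id C))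
    (fun x => idm (F x)) (natural (nat_id F)).

Definition Lex : bicategory.
Proof.
refine (@Bicategory lexcat (fun C D => lexfun C D)
  (fun C D F G => nattrans F G)
  (fun C => lexfun_id C)
  (fun C D E G F => lexfun_comp G F)
  (fun C D F => nat_id F)
  (fun C D F G H b a => nat_vcomp b a)
  (fun C D E G G' F F' b a => nat_hcomp b a)
  (fun A B C D H G F => nat_asc H G F)
  (fun A B C D H G F => nat_asc_inv H G F)
  (fun C D F => nat_lun F) (fun C D F => nat_lun_inv F)
  (fun C D F => nat_run F) (fun C D F => nat_run_inv F)
  _ _ _ _ _ _ _ _ _ _ _ _ _ _ _ _);
intros; apply nattrans_ext; intro x; simpl;
rewrite ?fmap_id, ?comp_idl, ?comp_idr, ?fmap_id; try reflexivity.
- apply comp_assoc.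
- rewrite fmap_comp, !comp_assoc. f_equal. rewrite <- !comp_assoc. f_equal.
  symmetry. apply natural.
- now rewrite fmap_comp, comp_assoc.
Defined.

Record congruence (C : category) := Congruence {
  crel :> forall x y : C, hom x y -> hom x y -> Prop;
  crel_refl : forall x y (f : hom x y), crel f f;
  crel_sym : forall x y (f g : hom x y), crel f g -> crel g f;
  crel_trans : forall x y (f g h : hom x y), crel f g -> crel g h -> crel f h;
  crel_comp : forall x y z (g g' : hom y z) (f f' : hom x y),
    crel g g' -> crel f f' -> crel (g ∘ f) (g' ∘ f')
}.

Section Quotient.
Variables (C : category) (R : congruence C).

(* Equivalence classes, as predicates. *)
Definition qhom (x y : C) : Type :=
  { p : hom x y -> Prop | exists f, p = R x y f }.

Definition qclass (x y : C) (f : hom x y) : qhom x y :=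
  exist _ (R x y f) (ex_intro _ f eq_refl).

Lemma qclass_eq (x y : C) (f g : hom x y) : qclass f = qclass g <-> R x y f g.
Proof.
split.
- intro e. apply (f_equal (@proj1_sig _ _)) in e. simpl in e.
  rewrite e. apply crel_refl.
- intro e. unfold qclass. apply subset_eq_compat.
  apply functional_extensionality. intro h. apply propositional_extensionality.
  split; intro H.
  + apply crel_trans with f; [apply crel_sym|]; assumption.
  + apply crel_trans with g; assumption.
Qed.

Lemma qclass_surj (x y : C) (p : qhom x y) : exists f, qclass f = p.
Proof.
destruct p as [p Hp]. destruct Hp as [f e]. subst p. exists f. reflexivity.
Qed.

Definition qrepr (x y : C) (p : qhom x y) : hom x y :=
  proj1_sig (constructive_indefinite_description _ (qclass_surj p)).

Lemma qreprK (x y : C) (p : qhom x y) : qclass (qrepr p) = p.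
Proof.
exact (proj2_sig (constructive_indefinite_description _ (qclass_surj p))).
Qed.

Lemma qrepr_class (x y : C) (f : hom x y) : R x y (qrepr (qclass f)) f.
Proof. apply qclass_eq, qreprK. Qed.

Definition qcomp (x y z : C) (q : qhom y z) (p : qhom x y) : qhom x z :=
  qclass (qrepr q ∘ qrepr p).

Lemma qcomp_class (x y z : C) (g : hom y z) (f : hom x y) :
  qcomp (qclass g) (qclass f) = qclass (g ∘ f).
Proof. apply qclass_eq, crel_comp; apply qrepr_class. Qed.

Definition quotient_category : category.
Proof.
refine (@Category C qhom (fun x => qclass (idm x)) qcomp _ _ _).
- intros x y p. rewrite <- (qreprK p), qcomp_class. now rewrite comp_idl.
- intros x y p. rewrite <- (qreprK p), qcomp_class. now rewrite comp_idr.
- intros x y z w r q p.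
  rewrite <- (qreprK r), <- (qreprK q), <- (qreprK p), !qcomp_class.
  now rewrite comp_assoc.
Defined.

Definition quotient_proj : functor C quotient_category.
Proof.
refine (@Functor C quotient_category (fun x => x) (fun x y f => qclass f) _ _).
- reflexivity.
- intros x y z g f. symmetry. apply qcomp_class.
Defined.

End Quotient.

Definition quotient_functor (C D : category) (R : congruence C) (S : congruence D)
    (F : functor C D)
    (HF : forall x y (f g : hom x y),
       R x y f g -> S (F x) (F y) (fmap F f) (fmap F g)) :
  functor (quotient_category R) (quotient_category S).
Proof.
refine (@Functor (quotient_category R) (quotient_category S) F
  (fun x y p => qclass S (fmap F (qrepr p))) _ _).
- intro x. simpl. rewrite <- (fmap_id F). apply qclass_eq, HF, qrepr_class.
- intros x y z q p. simpl. rewrite qcomp_class, <- fmap_comp.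
  apply qclass_eq, HF, qrepr_class.
Defined.

(* The Kan condition is spelled out through the existence of a "composition" [c]
   and of an "inversion" [t], neither of them being part of the structure. *)
Record eq2grpd (C : category) := Eq2Grpd {
  e0 : C;
  e1 : C;
  d0 : hom e1 e0;
  d1 : hom e1 e0;
  sg : hom e0 e1;
  d0_sg : d0 ∘ sg = idm e0;
  d1_sg : d1 ∘ sg = idm e0;
  eq2_trans : exists (p : C) (p1 p2 : hom p e1), is_pullback d1 d0 p1 p2 /\
    exists c : hom p e1, d0 ∘ c = d0 ∘ p1 /\ d1 ∘ c = d1 ∘ p2;
  eq2_sym : exists t : hom e1 e1, d0 ∘ t = d1 /\ d1 ∘ t = d0
}.

(* The compatibility of [m0] and [m1] with [(d0, d1) : e1 -> e0 × e0] is stated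
   componentwise, so as not to depend on a choice of products. *)
Record eq2mor (C : category) (A B : eq2grpd C) := Eq2Mor {
  m0 : hom (e0 A) (e0 B);
  m1 : hom (e1 A) (e1 B);
  m_d0 : d0 B ∘ m1 = m0 ∘ d0 A;
  m_d1 : d1 B ∘ m1 = m0 ∘ d1 A
}.

Lemma eq2mor_ext (C : category) (A B : eq2grpd C) (f g : eq2mor A B) :
  m0 f = m0 g -> m1 f = m1 g -> f = g.
Proof.
destruct f as [f0 f1 Hf0 Hf1], g as [g0 g1 Hg0 Hg1]; simpl; intros E0 E1.
subst g0 g1. f_equal; apply proof_irrelevance.
Qed.

Definition eq2mor_id (C : category) (A : eq2grpd C) : eq2mor A A.
Proof.
refine (@Eq2Mor C A A (idm _) (idm _) _ _); now rewrite comp_idl, comp_idr.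
Defined.

Definition eq2mor_comp (C : category) (A B D : eq2grpd C)
    (g : eq2mor B D) (f : eq2mor A B) : eq2mor A D.
Proof.
refine (@Eq2Mor C A D (m0 g ∘ m0 f) (m1 g ∘ m1 f) _ _).
- now rewrite comp_assoc, m_d0, <- comp_assoc, m_d0, comp_assoc.
- now rewrite comp_assoc, m_d1, <- comp_assoc, m_d1, comp_assoc.
Defined.

Definition E2 (C : category) : category.
Proof.
refine (@Category (eq2grpd C) (@eq2mor C) (@eq2mor_id C) (@eq2mor_comp C) _ _ _);
intros; apply eq2mor_ext; simpl;
rewrite ?comp_idl, ?comp_idr, ?comp_assoc; reflexivity.
Defined.

(* [(m0 f, m0 g)] factors through [(d0, d1) : e1 B -> e0 B × e0 B]. *)
Definition homotopic (C : category) (A B : eq2grpd C) (f g : eq2mor A B) : Prop :=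
  exists h : hom (e0 A) (e1 B), d0 B ∘ h = m0 f /\ d1 B ∘ h = m0 g.

Definition homotopy (C : category) : congruence (E2 C).
Proof.
assert (tr : forall (A B : E2 C) (f g h : eq2mor A B),
  homotopic f g -> homotopic g h -> homotopic f h).
{ intros A B f g h [u [u0 u1]] [v [v0 v1]].
  destruct (eq2_trans B) as [p [p1 [p2 [[_ univ] [c [c0 c1]]]]]].
  destruct (univ _ u v) as [w [[w1 w2] _]]; [congruence|].
  exists (c ∘ w). split.
  - now rewrite comp_assoc, c0, <- comp_assoc, w1.
  - now rewrite comp_assoc, c1, <- comp_assoc, w2. }
refine (@Congruence (E2 C) (@homotopic C) _ _ tr _).
- intros A B f. exists (sg B ∘ m0 f).
  now rewrite !comp_assoc, d0_sg, d1_sg, comp_idl.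
- intros A B f g [h [h0 h1]]. destruct (eq2_sym B) as [t [t0 t1]].
  exists (t ∘ h). now rewrite !comp_assoc, t0, t1.
- intros A B D g g' f f' [k [k0 k1]] [h [h0 h1]]. apply tr with (eq2mor_comp g f').
  + exists (m1 g ∘ h). simpl.
    rewrite !comp_assoc, m_d0, m_d1, <- !comp_assoc, h0, h1. auto.
  + exists (k ∘ m0 f'). simpl. rewrite !comp_assoc, k0, k1. auto.
Defined.

Definition Eh (C : category) : category := quotient_category (homotopy C).

Definition disc (C : category) (x : C) : eq2grpd C.
Proof.
refine (@Eq2Grpd C x x (idm x) (idm x) (idm x) (comp_idl _) (comp_idl _) _ _).
- exists x, (idm x), (idm x). split.
  + split; [reflexivity|]. intros y u v e. rewrite !comp_idl in e. subst v.
    exists u. split.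
    * now rewrite comp_idl.
    * intros w [H _]. now rewrite comp_idl in H.
  + exists (idm x). auto.
- exists (idm x). now rewrite comp_idl.
Defined.

Definition disc_mor (C : category) (x y : C) (f : hom x y) :
  eq2mor (disc x) (disc y).
Proof.
refine (@Eq2Mor C (disc x) (disc y) f f _ _); simpl;
now rewrite comp_idl, comp_idr.
Defined.

Definition E2_emb (C : category) : functor C (E2 C).
Proof.
refine (@Functor C (E2 C) (@disc C) (@disc_mor C) _ _);
intros; apply eq2mor_ext; reflexivity.
Defined.

Definition Eh_emb (C : category) : functor C (Eh C) :=
  functor_comp (quotient_proj (homotopy C)) (E2_emb C).

Section Functoriality.
Variables (C D : category) (F : lexfun C D).

Definition E2_map_ob (A : eq2grpd C) : eq2grpd D.
Proof.
refine (@Eq2Grpd D (F (e0 A)) (F (e1 A)) (fmap F (d0 A)) (fmap F (d1 A))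
  (fmap F (sg A)) _ _ _ _).
- now rewrite <- fmap_comp, d0_sg, fmap_id.
- now rewrite <- fmap_comp, d1_sg, fmap_id.
- destruct (eq2_trans A) as [p [p1 [p2 [H [c [c0 c1]]]]]].
  exists (F p), (fmap F p1), (fmap F p2). split.
  + exact (preserves_pullback (lex_preserves F) H).
  + exists (fmap F c). now rewrite <- !fmap_comp, c0, c1.
- destruct (eq2_sym A) as [t [t0 t1]]. exists (fmap F t).
  now rewrite <- !fmap_comp, t0, t1.
Defined.

Definition E2_map_mor (A B : eq2grpd C) (f : eq2mor A B) :
  eq2mor (E2_map_ob A) (E2_map_ob B).
Proof.
refine (@Eq2Mor D (E2_map_ob A) (E2_map_ob B) (fmap F (m0 f)) (fmap F (m1 f)) _ _);
simpl; rewrite <- !fmap_comp; f_equal; [apply m_d0|apply m_d1].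
Defined.

Definition E2_map : functor (E2 C) (E2 D).
Proof.
refine (@Functor (E2 C) (E2 D) E2_map_ob E2_map_mor _ _);
intros; apply eq2mor_ext; simpl; apply fmap_id || apply fmap_comp.
Defined.

Lemma E2_map_homotopic (A B : E2 C) (f g : hom A B) :
  homotopy C A B f g ->
  homotopy D (E2_map A) (E2_map B) (fmap E2_map f) (fmap E2_map g).
Proof.
intros [h [h0 h1]]. exists (fmap F h). simpl. now rewrite <- !fmap_comp, h0, h1.
Qed.

Definition Eh_map : functor (Eh C) (Eh D) := quotient_functor E2_map_homotopic.

(* [Eh_emb] sends [F x] to [(F x, F x)] with identity structure maps, and [Eh_map]
   sends [(x, x)] to [(F x, F x)] with structure maps [F (idm x)]; these are
   identified by the pair of identities. *)
Definition disc_map (x : C) : eq2mor (disc (F x)) (E2_map_ob (disc x)).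
Proof.
refine (@Eq2Mor D (disc (F x)) (E2_map_ob (disc x)) (idm _) (idm _) _ _);
simpl; now rewrite fmap_id.
Defined.

Definition Eh_emb_map :
  nattrans (functor_comp (Eh_emb D) F) (functor_comp Eh_map (Eh_emb C)).
Proof.
refine (@Nattrans C (Eh D)
  (functor_comp (Eh_emb D) F) (functor_comp Eh_map (Eh_emb C))
  (fun x => qclass (homotopy D) (disc_map x)) _).
intros x y u.
assert (e : fmap (functor_comp Eh_map (Eh_emb C)) u =
  qclass (homotopy D) (fmap E2_map (disc_mor u))).
{ apply qclass_eq, E2_map_homotopic, qrepr_class. }
rewrite e. simpl. rewrite !qcomp_class. f_equal.
apply eq2mor_ext; simpl; now rewrite comp_idl, comp_idr.
Defined.

End Functoriality.

Definition Eh_kz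
    (HE : forall C : lexcat, has_finite_limits (Eh C))
    (Hi : forall C : lexcat, preserves_finite_limits (Eh_emb C)) : kz_data Lex :=
  @KZData Lex (fun C : lexcat => LexCat (HE C))
    (fun C : lexcat => LexFun (Hi C)).

(* Main.v *)
(* [Eh C] is the exact completion of the lex category [C].  Every [A] in it is the
   coequalizer [pres A] of the two maps between images of objects of [C] given by
   [d0 A] and [d1 A], and maps into [B] from the image of [T] are maps [T -> e0 B]
   modulo the relation given by [e1 B].  Hence limits in [Eh C] can be tested on
   maps out of the image of [C], and a lex functor on [Eh C] that preserves these
   coequalizers ([presenting]) is the left Kan extension of its restriction to [C].
   An equivalence 2-groupoid [A] in [Eh D] has a quotient in [Eh D], with the same
   points as [e0 A]; this gives a functor [mult : Eh (Eh D) -> Eh D].  It is lex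
   because maps from the image of [T] to [mult A] are the maps from the image of [T]
   in [Eh (Eh D)] to [A].  So [mult] composed with [Eh_map F] extends
   [F : C -> Eh D].  Each canonical 2-morphism required to be invertible compares
   a left Kan extension with a presenting functor that restricts, up to isomorphism,
   to the extended one; the latter is then a left Kan extension as well. *)
Require Import Defs.
From Stdlib Require Import List FinFun.
From Stdlib Require Import FunctionalExtensionality ProofIrrelevance.
From Stdlib Require Import ClassicalEpsilon.

Set Implicit Arguments.
Unset Strict Implicit.
Unset Printing Implicit Defensive.

(** * Choice, isomorphisms and coequalizers *)

Lemma dependent_choice (I : Type) (X : I -> Type) (P : forall i, X i -> Prop) :
  (forall i, exists x, P i x) -> exists f : forall i, X i, forall i, P i (f i).
Proof.
intro H.
exists (fun i => proj1_sig (constructive_indefinite_description _ (H i))).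
intro i. apply proj2_sig.
Qed.

Definition is_iso (C : category) (x y : C) (f : hom x y) : Prop :=
  exists g : hom y x, g ∘ f = idm x /\ f ∘ g = idm y.

Lemma is_iso_id (C : category) (x : C) : is_iso (idm x).
Proof. exists (idm x). now rewrite comp_idl. Qed.

Lemma is_iso_comp (C : category) (x y z : C) (g : hom y z) (f : hom x y) :
  is_iso g -> is_iso f -> is_iso (g ∘ f).
Proof.
intros [g' [G1 G2]] [f' [F1 F2]]. exists (f' ∘ g'). split.
- now rewrite comp_assoc, <- (comp_assoc f'), G1, comp_idr.
- now rewrite comp_assoc, <- (comp_assoc g), F2, comp_idr.
Qed.

Lemma is_iso_fmap (C D : category) (F : functor C D) (x y : C) (f : hom x y) :
  is_iso f -> is_iso (fmap F f).
Proof.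
intros [g [e1 e2]]. exists (fmap F g).
now rewrite <- !fmap_comp, e1, e2, !fmap_id.
Qed.

Definition is_coeq (C : category) (a b c : C) (f g : hom a b) (q : hom b c) : Prop :=
  q ∘ f = q ∘ g /\
  forall (z : C) (k : hom b z), k ∘ f = k ∘ g -> exists! w : hom c z, w ∘ q = k.

Lemma coeq_epi (C : category) (a b c : C) (f g : hom a b) (q : hom b c) :
  is_coeq f g q -> forall (z : C) (w w' : hom c z), w ∘ q = w' ∘ q -> w = w'.
Proof.
intros [e H] z w w' E. destruct (H z (w ∘ q)) as [v [_ U]].
- now rewrite <- !comp_assoc, e.
- now rewrite <- (U w), <- (U w').
Qed.

(** Isomorphisms are epimorphisms, so equations on the primed fork can be tested after precomposing
    with [s] or [t]. This later moves coequalizers along natural isomorphisms. *)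
Lemma coeq_iso (C : category) (a b c a' b' c' : C) (f g : hom a b) (q : hom b c)
    (f' g' : hom a' b') (q' : hom b' c')
    (s : hom a a') (t : hom b b') (u : hom c c') :
  is_iso s -> is_iso t -> is_iso u ->
  f' ∘ s = t ∘ f -> g' ∘ s = t ∘ g -> q' ∘ t = u ∘ q ->
  is_coeq f g q -> is_coeq f' g' q'.
Proof.
intros [s' [s1 s2]] [t' [t1 t2]] [u' [u1 u2]] ef eg eq Q.
assert (epi_s : forall z (w w' : hom a' z), w ∘ s = w' ∘ s -> w = w').
{ intros z w w' E. rewrite <- (comp_idr w), <- (comp_idr w'), <- s2.
  now rewrite !comp_assoc, E. }
assert (epi_t : forall z (w w' : hom b' z), w ∘ t = w' ∘ t -> w = w').
{ intros z w w' E. rewrite <- (comp_idr w), <- (comp_idr w'), <- t2.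
  now rewrite !comp_assoc, E. }
split.
- apply epi_s. rewrite <- !comp_assoc, ef, eg, !comp_assoc, eq, <- !comp_assoc.
  f_equal. apply Q.
- intros z k E. destruct Q as [_ H]. destruct (H z (k ∘ t)) as [w [w1 U]].
  { rewrite <- !comp_assoc, <- ef, <- eg, !comp_assoc. now f_equal. }
  exists (w ∘ u'). split.
  + apply epi_t. now rewrite <- !comp_assoc, eq, (comp_assoc u'), u1, comp_idl.
  + intros v Hv. rewrite (U (v ∘ u)).
    * now rewrite <- comp_assoc, u2, comp_idr.
    * now rewrite <- comp_assoc, <- eq, comp_assoc, Hv.
Qed.

(** * Closure properties of finite types *)

Lemma finite_sum (A B : Type) : Finite A -> Finite B -> Finite (A + B).
Proof.
intros [l Hl] [m Hm]. exists (map inl l ++ map inr m).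
intros [a|b]; apply in_or_app; [left|right]; apply in_map; auto.
Qed.

Lemma finite_sigma (A : Type) (B : A -> Type) :
  Finite A -> (forall a, Finite (B a)) -> Finite {a : A & B a}.
Proof.
intros [l Hl] H. apply dependent_choice in H. destruct H as [m Hm].
exists (flat_map (fun a => map (existT B a) (m a)) l).
intros [a b]. apply in_flat_map. exists a. split; [apply Hl|]. apply in_map, Hm.
Qed.

Lemma finite_unit : Finite unit.
Proof. exists (tt :: nil). intros []. simpl. auto. Qed.

Lemma finite_bool : Finite bool.
Proof. exists (true :: false :: nil). intros []; simpl; auto. Qed.

(** Excluded middle chooses between a one-element list and the empty one. This makes hom-sets
    consisting of equality proofs finite. *)
Lemma finite_prop (P : Prop) : Finite P.
Proof.
destruct (excluded_middle_informative P) as [p|n].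
- exists (p :: nil). intro q. left. apply proof_irrelevance.
- exists nil. intro q. now destruct (n q).
Qed.

Lemma finite_sig (A : Type) (P : A -> Prop) : Finite A -> Finite {a : A | P a}.
Proof.
intro HA.
destruct (@finite_sigma A P HA (fun a => finite_prop (P a))) as [l Hl].
exists (map (fun s : {a : A & P a} => exist P (projT1 s) (projT2 s)) l).
intros [a p]. apply in_map_iff. exists (existT (fun a => P a) a p). split; auto.
Qed.

(** * Finite systems of equations and their universal solutions *)

(** A finite limit given by unknowns and equations between their images, which is shorter to
    instantiate than an index category with a functor. *)
Record system (C : category) := System {
  var : Type;
  eqn : Type;
  var_ob : var -> C;
  eqn_ob : eqn -> C;
  lvar : eqn -> var;
  rvar : eqn -> var;
  lmap : forall k, hom (var_ob (lvar k)) (eqn_ob k);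
  rmap : forall k, hom (var_ob (rvar k)) (eqn_ob k)
}.

Definition system_map (C D : category) (F : functor C D) (S : system C) : system D :=
  @System D (var S) (eqn S) (fun i => F (var_ob i)) (fun k => F (eqn_ob k))
    (@lvar C S) (@rvar C S) (fun k => fmap F (lmap k)) (fun k => fmap F (rmap k)).

Section Solutions.
Variables (C : category) (S : system C).

Definition solves (T : C) (x : forall i : var S, hom T (var_ob i)) : Prop :=
  forall k, lmap k ∘ x (lvar k) = rmap k ∘ x (rvar k).

Definition universal (L : C) (p : forall i : var S, hom L (var_ob i)) : Prop :=
  solves p /\
  forall T (x : forall i : var S, hom T (var_ob i)), solves x ->
    exists! w : hom T L, forall i, p i ∘ w = x i.

(** Arrows other than identities go from an unknown to an equation in which it occurs. The boolean
    names the side, so an unknown on both sides has two distinct arrows. Identities are encoded as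
    equality proofs, unique by proof irrelevance. *)
Definition sketch_hom (x y : var S + eqn S) : Type :=
  match x, y with
  | inl i, inl j => i = j
  | inl i, inr k => {s : bool | (if s then lvar k else rvar k) = i}
  | inr k, inr k' => k = k'
  | inr _, inl _ => Empty_set
  end.

Definition sketch_id x : sketch_hom x x :=
  match x with inl i => eq_refl i | inr k => eq_refl k end.

Definition sketch_comp x y z : sketch_hom y z -> sketch_hom x y -> sketch_hom x z.
Proof.
destruct x as [i|k], y as [i'|k'], z as [i''|k'']; simpl; intros g f;
  try contradiction.
- exact (eq_trans f g).
- exact (exist _ (proj1_sig g) (eq_trans (proj2_sig g) (eq_sym f))).
- subst k''. exact f.
- exact (eq_trans f g).
Defined.

Definition sketch : category.
Proof.
refine (@Category (var S + eqn S) sketch_hom sketch_id sketch_comp _ _ _).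
- intros [i|k] [i'|k'] f; simpl in *; try contradiction; try apply proof_irrelevance.
  reflexivity.
- intros [i|k] [i'|k'] f; simpl in *; try contradiction; try apply proof_irrelevance.
  destruct f; apply subset_eq_compat; reflexivity.
- intros [x|x] [y|y] [z|z] [w|w] h g f; simpl in *; try contradiction;
    try apply proof_irrelevance; subst; simpl;
    try (apply subset_eq_compat; reflexivity); reflexivity.
Defined.

Lemma sketch_finite : Finite (var S) -> Finite (eqn S) -> finite_category sketch.
Proof.
intros HI HK. split; [now apply finite_sum|].
intros [i|k] [j|k']; simpl; try apply finite_prop.
- apply finite_sig, finite_bool.
- exists nil. intros [].
Qed.

Definition sketch_ob (x : var S + eqn S) : C :=
  match x with inl i => var_ob i | inr k => eqn_ob k end.

Definition sketch_map x y : sketch_hom x y -> hom (sketch_ob x) (sketch_ob y).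
Proof.
destruct x as [i|k], y as [j|k']; simpl; intro f.
- destruct f. exact (idm _).
- destruct f as [[|] e]; destruct e; [exact (lmap k')|exact (rmap k')].
- contradiction.
- destruct f. exact (idm _).
Defined.

Definition sketch_functor : functor sketch C.
Proof.
refine (@Functor sketch C sketch_ob sketch_map _ _).
- intros [i|k]; reflexivity.
- intros [x|x] [y|y] [z|z] g f; simpl in *; try contradiction;
    repeat match goal with
    | s : {_ : bool | _} |- _ => destruct s as [[|] ?]
    end; subst; simpl; rewrite ?comp_idl, ?comp_idr; reflexivity.
Defined.

(** At an equation the leg is the common value of both sides, here computed from the left one; cones
    over [sketch_functor] thus amount to solutions. *)
Definition solution_cone (L : C) (p : forall i : var S, hom L (var_ob i)) :
  forall x : sketch, hom L (sketch_functor x) :=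
  fun x => match x return hom L (sketch_ob x) with
    | inl i => p i
    | inr k => lmap k ∘ p (lvar k) end.

Lemma universal_exists :
  has_finite_limits C -> Finite (var S) -> Finite (eqn S) ->
  exists L p, @universal L p.
Proof.
intros HC HI HK.
destruct (HC _ (sketch_finite HI HK) sketch_functor) as [L [l [cone univ]]].
exists L, (fun i => l (inl i)). split.
- intro k.
  transitivity (l (inr k)); [|symmetry].
  + exact (cone (inl (lvar k)) (inr k) (exist _ true eq_refl)).
  + exact (cone (inl (rvar k)) (inr k) (exist _ false eq_refl)).
- intros T x Hx. destruct (univ T (solution_cone x)) as [w [Hw U]].
  + intros [i|k] [j|k'] f; simpl in *; try contradiction.
    * subst. apply comp_idl.
    * destruct f as [[|] e]; subst; simpl; [reflexivity|]. symmetry. apply Hx.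
    * subst. apply comp_idl.
  + exists w. split; [intro i; exact (Hw (inl i))|].
    intros w' H. apply U. intros [i|k]; [apply H|]. simpl. rewrite <- H.
    rewrite comp_assoc. f_equal. symmetry.
    exact (cone (inl (lvar k)) (inr k) (exist _ true eq_refl)).
Qed.

Lemma universal_limit (L : C) (p : forall i : var S, hom L (var_ob i)) :
  universal p -> is_limit (solution_cone p).
Proof.
intros [Hp univ]. split.
- intros [i|k] [j|k'] f; simpl in *; try contradiction.
  + subst. apply comp_idl.
  + destruct f as [[|] e]; subst; simpl; [reflexivity|]. symmetry. apply Hp.
  + subst. apply comp_idl.
- intros T m Hm. destruct (univ T (fun i => m (inl i))) as [w [Hw U]].
  + intro k. transitivity (m (inr k)); [|symmetry].
    * exact (Hm (inl (lvar k)) (inr k) (exist _ true eq_refl)).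
    * exact (Hm (inl (rvar k)) (inr k) (exist _ false eq_refl)).
  + exists w. split.
    * intros [i|k]; simpl; [apply Hw|]. rewrite <- comp_assoc, Hw.
      exact (Hm (inl (lvar k)) (inr k) (exist _ true eq_refl)).
    * intros w' H. apply U. intro i. exact (H (inl i)).
Qed.

End Solutions.

Lemma universal_map (C D : category) (F : functor C D) (S : system C) (L : C)
    (p : forall i : var S, hom L (var_ob i)) :
  Finite (var S) -> Finite (eqn S) -> preserves_finite_limits F -> universal p ->
  universal (S := system_map F S) (fun i => fmap F (p i)).
Proof.
intros HI HK HF Hp.
destruct (HF _ (sketch_finite HI HK) _ _ _ (universal_limit Hp)) as [_ univ].
split.
- intro k. simpl. rewrite <- !fmap_comp. f_equal. apply Hp.
- intros T x Hx.
  (* [univ] is about cones over [sketch S], so the solution [x] of the image system is completed by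
     the values of its left sides. *)
  pose (m := fun j : sketch S =>
    match j return hom T (F (sketch_ob j)) with
    | inl i => x i
    | inr k => lmap (s := system_map F S) k ∘ x (lvar k) end).
  destruct (univ T m) as [w [Hw U]].
  + intros [i|k] [j|k'] f; simpl in *; try contradiction.
    * subst. simpl. rewrite fmap_id. apply comp_idl.
    * destruct f as [[|] e]; subst; simpl; [reflexivity|]. symmetry. apply Hx.
    * subst. simpl. rewrite fmap_id. apply comp_idl.
  + exists w. split.
    * intro i. exact (Hw (inl i)).
    * intros w' H. apply U. intros [i|k]; simpl; [apply H|].
      rewrite fmap_comp, <- comp_assoc. f_equal. apply H.
Qed.

(** * Presentations by objects of the base *)

Notation ι f := (fmap (Eh_emb _) f).

(** Only the existence of [h] is recorded, since [s] and [t] need not be jointly monic. *)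
Definition related (C : category) (x0 x1 : C) (s t : hom x1 x0) (T : C)
    (f g : hom T x0) : Prop :=
  exists h : hom T x1, s ∘ h = f /\ t ∘ h = g.

Section Presentation.
Variable C : category.

Lemma class_eq (A B : Eh C) (f g : eq2mor A B) :
  (qclass (homotopy C) f : hom A B) = qclass (homotopy C) g <-> homotopic f g.
Proof. apply (qclass_eq (homotopy C)). Qed.

Definition pres2 (A : eq2grpd C) : eq2mor (disc (e0 A)) A.
Proof.
refine (@Eq2Mor C (disc (e0 A)) A (idm _) (sg A) _ _); simpl;
[rewrite d0_sg|rewrite d1_sg]; now rewrite comp_idl.
Defined.

Definition pres (A : Eh C) : hom (Eh_emb C (e0 A)) A := qclass (homotopy C) (pres2 A).

Lemma pres_emb (T : C) (A : Eh C) (f : hom T (e0 A)) :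
  pres A ∘ ι f = qclass (homotopy C) (eq2mor_comp (pres2 A) (disc_mor f)).
Proof. apply (qcomp_class (homotopy C)). Qed.

(** Homotopy only sees degree zero, so a representative [f] may be replaced by [m0 f] followed by
    the presentation. In this sense images of objects of [C] are projective. *)
Lemma disc_lift (T : C) (A : Eh C) (t : hom (Eh_emb C T) A) :
  exists f : hom T (e0 A), t = pres A ∘ ι f.
Proof.
destruct (qclass_surj t) as [f <-]. exists (m0 f).
rewrite pres_emb. apply qclass_eq. exists (sg A ∘ m0 f). simpl.
now rewrite !comp_assoc, d0_sg, d1_sg, !comp_idl.
Qed.

Lemma pres_eq (T : C) (A : Eh C) (f g : hom T (e0 A)) :
  pres A ∘ ι f = pres A ∘ ι g <-> related (d0 A) (d1 A) f g.
Proof.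
rewrite !pres_emb, class_eq. unfold homotopic. simpl.
now rewrite !comp_idl.
Qed.

Lemma pres_disc (x : C) : pres (Eh_emb C x) = idm _.
Proof.
apply (qclass_eq (homotopy C)). exists (idm x). simpl. now rewrite comp_idl.
Qed.

(** If [g] coequalizes, its lift [f : e0 A -> e0 B] comes with a homotopy [h : e1 A -> e1 B] from
    [f ∘ d0 A] to [f ∘ d1 A]. The equations on [h] are precisely those that make [f] and [h] a
    morphism from [A] to [B]. *)
Lemma pres_coeq (A : Eh C) : is_coeq (ι (d0 A)) (ι (d1 A)) (pres A).
Proof.
split.
- apply pres_eq. exists (idm _). now rewrite !comp_idr.
- intros B g E. destruct (disc_lift g) as [f ->].
  rewrite <- !comp_assoc, <- !fmap_comp in E. apply pres_eq in E.
  destruct E as [h [h0 h1]].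
  exists (qclass (homotopy C) (@Eq2Mor C A B f h h0 h1)). split.
  + rewrite pres_emb. etransitivity; [apply (qcomp_class (homotopy C))|].
    apply qclass_eq. exists (sg B ∘ f). simpl.
    now rewrite !comp_assoc, d0_sg, d1_sg, !comp_idl, comp_idr.
  + intros w H. destruct (qclass_surj w) as [k <-].
    rewrite pres_emb in H. apply qclass_eq.
    assert (H' := eq_trans (eq_sym (qcomp_class (homotopy C) k (pres2 A))) H).
    apply qclass_eq in H'. destruct H' as [h' [h'0 h'1]]. simpl in *.
    rewrite comp_idr in h'0. rewrite comp_idl in h'1.
    (* [h'] leads from [m0 k] to [f], and the goal asks for the opposite direction. *)
    destruct (eq2_sym B) as [t [t0 t1]].
    exists (t ∘ h'). simpl. now rewrite !comp_assoc, t0, t1.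
Qed.

Lemma pres_epi (A B : Eh C) (f g : hom A B) : f ∘ pres A = g ∘ pres A -> f = g.
Proof. apply (coeq_epi (pres_coeq A)). Qed.

Lemma hom_lift (A B : Eh C) (f : hom A B) :
  exists f0 : hom (e0 A) (e0 B), f ∘ pres A = pres B ∘ ι f0.
Proof. apply disc_lift. Qed.

(** For the image of [y] the presentation is an identity and the relation is equality, so
    [disc_lift] gives existence and [pres_eq] uniqueness. *)
Lemma Eh_emb_fully_faithful : fully_faithful (Eh_emb C).
Proof.
intros x y g. destruct (disc_lift g) as [f e].
rewrite pres_disc, comp_idl in e. exists f. split; [easy|].
intros f' <-. assert (H : pres (Eh_emb C y) ∘ ι f = pres (Eh_emb C y) ∘ ι f')
  by now rewrite pres_disc, !comp_idl.
apply pres_eq in H. destruct H as [h [<- <-]]. reflexivity.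
Qed.

Lemma Eh_emb_faithful (x y : C) (f g : hom x y) : ι f = ι g -> f = g.
Proof.
intro e. destruct (Eh_emb_fully_faithful (ι f)) as [f' [_ U]].
now rewrite <- (U f), <- (U g).
Qed.

(* Maps out of [A] are an equalizer of maps out of two objects of [C], naturally
   in the target, and equalizers commute with limits. *)
Lemma limit_disc (J : category) (D : functor J (Eh C)) (L : Eh C)
    (l : forall j, hom L (D j)) :
  is_cone l ->
  (forall (T : C) (m : forall j, hom (Eh_emb C T) (D j)), is_cone m ->
     exists! u, forall j, l j ∘ u = m j) ->
  is_limit l.
Proof.
intros Hl H. split; [exact Hl|]. intros Y m Hm.
destruct (H (e0 Y) (fun j => m j ∘ pres Y)) as [u [Hu U]].
{ intros j k v. now rewrite comp_assoc, Hm. }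
destruct (pres_coeq Y) as [E _].
(* Uniqueness at stage [e1 Y] shows that [u] coequalizes the presentation of [Y], hence descends to
   [Y]. *)
destruct (H (e1 Y) (fun j => m j ∘ pres Y ∘ ι (d0 Y))) as [v [Hv V]].
{ intros j k w. now rewrite !comp_assoc, Hm. }
assert (e : u ∘ ι (d0 Y) = u ∘ ι (d1 Y)).
{ rewrite <- (V (u ∘ ι (d0 Y))), <- (V (u ∘ ι (d1 Y))); auto;
  intro j; rewrite comp_assoc, Hu; auto. now rewrite <- !comp_assoc, E. }
destruct (proj2 (pres_coeq Y) _ _ e) as [k [Hk K]].
exists k. split.
- intro j. apply pres_epi. now rewrite <- comp_assoc, Hk.
- intros k' H'. apply K. symmetry. apply U. intro j. now rewrite comp_assoc, H'.
Qed.

(** Cones out of images of objects lift along the fully faithful embedding, and [limit_disc] asks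
    for no others. *)
Lemma Eh_emb_preserves : preserves_finite_limits (Eh_emb C).
Proof.
intros J _ D x l [Hl univ]. apply limit_disc.
- intros j k u. change (ι (fmap D u) ∘ ι (l j) = ι (l k)).
  now rewrite <- fmap_comp, Hl.
- intros T m Hm.
  assert (Hf : forall j, exists f : hom T (D j), ι f = m j).
  { intro j. destruct (Eh_emb_fully_faithful (m j)) as [f [e _]]. eauto. }
  destruct (dependent_choice Hf) as [f ef].
  destruct (univ T f) as [w [Hw U]].
  { intros j k u. apply Eh_emb_faithful. rewrite fmap_comp, !ef. apply Hm. }
  exists (ι w). split.
  + intro j. change (ι (l j) ∘ ι w = m j). rewrite <- fmap_comp, Hw. apply ef.
  + intros v Hv. destruct (Eh_emb_fully_faithful v) as [v' [<- _]]. f_equal.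
    apply U. intro j. apply Eh_emb_faithful. rewrite fmap_comp, ef.
    apply Hv.
Qed.

End Presentation.

(** * Finite limits *)

Lemma pullback_exists (C : category) (a b c : C) (f : hom a c) (g : hom b c) :
  has_finite_limits C ->
  exists (p : C) (p1 : hom p a) (p2 : hom p b), is_pullback f g p1 p2.
Proof.
intro HC.
destruct (@universal_exists C (@System C bool unit
  (fun s => if s then a else b) (fun _ => c) (fun _ => true) (fun _ => false)
  (fun _ => f) (fun _ => g)) HC finite_bool finite_unit) as [p [q [e univ]]].
exists p, (q true), (q false). split; [exact (e tt)|].
intros x u v E.
destruct (univ x (fun s => match s with true => u | false => v end))
  as [w [Hw U]]; [intro; exact E|].
exists w. split.
- split; [exact (Hw true)|exact (Hw false)].
- intros w' [H1 H2]. apply U. intros []; assumption.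
Qed.

Section Relation.
Variables (C : category) (x0 x1 : C) (s t : hom x1 x0).

Hypothesis HC : has_finite_limits C.
Hypothesis refl : forall (T : C) (f : hom T x0), related s t f f.
Hypothesis sym : forall (T : C) (f g : hom T x0), related s t f g -> related s t g f.
Hypothesis trans : forall (T : C) (f g h : hom T x0),
  related s t f g -> related s t g h -> related s t f h.

(** A Yoneda argument: reflexivity at [idm x0] gives [sg], symmetry at [idm x1] the inversion, and
    transitivity at the pullback the composition. *)
Definition eq2grpd_of_related : eq2grpd C.
Proof.
pose (r := constructive_indefinite_description _ (refl (idm x0))).
refine (@Eq2Grpd C x0 x1 s t (proj1_sig r)
  (proj1 (proj2_sig r)) (proj2 (proj2_sig r)) _ _).
- destruct (@pullback_exists C _ _ _ t s HC) as [p [p1 [p2 H]]].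
  exists p, p1, p2. split; [exact H|].
  apply trans with (t ∘ p1); [exists p1; auto|].
  destruct H as [-> _]. exists p2. auto.
- apply sym. exists (idm x1). now rewrite !comp_idr.
Defined.

End Relation.

(** * Action of lex functors on presentations *)

Section EhMap.
Variables (C D : category) (F : lexfun C D).

Lemma Eh_map_class (A B : eq2grpd C) (f : eq2mor A B) :
  fmap (Eh_map F) (qclass (homotopy C) f : hom (c := Eh C) A B) =
  qclass (homotopy D) (E2_map_mor F f).
Proof.
apply (qclass_eq (homotopy D)).
exact (E2_map_homotopic F (qrepr_class (homotopy C) f)).
Qed.

(* Convertible to [Eh_emb_map F x], but with a type that does not mention
   [functor_comp]: unifying [functor_comp (Eh_map F) (Eh_emb C) x] with
   [Eh_map F (Eh_emb C x)] is very slow. *)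
Definition Eh_cmp (x : C) : hom (Eh_emb D (F x)) (Eh_map F (Eh_emb C x)) :=
  qclass (homotopy D) (disc_map F x).

Lemma Eh_cmp_natural (x y : C) (u : hom x y) :
  fmap (Eh_map F) (ι u) ∘ Eh_cmp x = Eh_cmp y ∘ ι (fmap F u).
Proof. exact (natural (Eh_emb_map F) u). Qed.

Lemma Eh_cmp_iso (x : C) : is_iso (Eh_cmp x).
Proof.
assert (H : exists g : eq2mor (E2_map_ob F (disc x)) (disc (F x)),
  m0 g = idm _ /\ m1 g = idm _).
{ unshelve eexists (@Eq2Mor D (E2_map_ob F (disc x)) (disc (F x)) (idm _) (idm _) _ _);
  simpl; rewrite ?fmap_id; auto. }
destruct H as [g [g0 g1]].
exists (qclass (homotopy D) g). split; (etransitivity;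
  [apply (qcomp_class (homotopy D))|]; apply (f_equal (@qclass _ (homotopy D) _ _));
  apply eq2mor_ext; simpl; rewrite ?g0, ?g1; apply comp_idl).
Qed.

Lemma Eh_map_pres (A : Eh C) :
  fmap (Eh_map F) (pres A) ∘ Eh_cmp (e0 A) = pres (Eh_map F A).
Proof.
unfold pres. rewrite Eh_map_class.
etransitivity; [apply (qcomp_class (homotopy D))|].
apply (f_equal (@qclass _ (homotopy D) _ _)).
apply eq2mor_ext; simpl; rewrite ?fmap_id; [apply comp_idl|apply comp_idr].
Qed.

(** Computes [Eh_map F] on a morphism known only through a lift to degree zero, without a
    representative in [E2 C]. *)
Lemma Eh_map_lift (A B : Eh C) (f : hom A B) (f0 : hom (e0 A) (e0 B)) :
  f ∘ pres A = pres B ∘ ι f0 ->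
  fmap (Eh_map F) f ∘ pres (Eh_map F A) = pres (Eh_map F B) ∘ ι (fmap F f0).
Proof.
intro e. rewrite <- !Eh_map_pres, comp_assoc, <- fmap_comp, e, fmap_comp.
rewrite <- !comp_assoc, Eh_cmp_natural. reflexivity.
Qed.

End EhMap.

(** * Limits in [Eh C] built from finite systems in [C] *)

Section LimitCriterion.
Variables (C J : category) (D : functor J (Eh C)) (L : Eh C)
  (l : forall j, hom L (D j))
  (r : forall j k : J, hom j k -> hom (e0 (D j)) (e0 (D k)))
  (n : forall j, hom (e0 L) (e0 (D j))).
Hypothesis Hr : forall j k (u : hom j k), fmap D u ∘ pres _ = pres _ ∘ ι (r u).
Hypothesis Hn : forall j, l j ∘ pres L = pres _ ∘ ι (n j).
Hypothesis Hc : forall j k (u : hom j k),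
  related (d0 (D k)) (d1 (D k)) (r u ∘ n j) (n k).
Hypothesis Hex : forall (T : C) (x : forall j, hom T (e0 (D j))),
  (forall j k (u : hom j k), related (d0 (D k)) (d1 (D k)) (r u ∘ x j) (x k)) ->
  exists w, forall j, n j ∘ w = x j.
Hypothesis Hun : forall (T : C) (a b : hom T (e0 L)),
  (forall j, related (d0 (D j)) (d1 (D j)) (n j ∘ a) (n j ∘ b)) ->
  related (d0 L) (d1 L) a b.

(** By [limit_disc] it suffices to test on images of objects [T], where morphisms are elements
    modulo homotopy: [Hex] gives existence and [Hun] uniqueness. As [Hc], [Hex] and [Hun] only
    concern [C], they can be checked again after applying a lex functor. *)
Lemma limit_criterion : is_limit l.
Proof.
apply limit_disc.
- intros j k u. apply pres_epi.
  rewrite <- comp_assoc, !Hn, comp_assoc, Hr, <- comp_assoc, <- fmap_comp.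
  apply pres_eq, Hc.
- intros T m Hm.
  destruct (dependent_choice (fun j => disc_lift (m j))) as [x Hx].
  destruct (Hex (T := T) (x := x)) as [w Hw].
  { intros j k u. apply pres_eq.
    rewrite fmap_comp, comp_assoc, <- Hr, <- comp_assoc, <- !Hx.
    apply Hm. }
  assert (Hl : forall T' j (v : hom T' (e0 L)),
    l j ∘ (pres L ∘ ι v) = pres _ ∘ ι (n j ∘ v)).
  { intros T' j v. now rewrite comp_assoc, Hn, <- comp_assoc, fmap_comp. }
  exists (pres L ∘ ι w). split.
  + intro j. now rewrite Hl, Hw, Hx.
  + intros v Hv. destruct (disc_lift v) as [b ->]. apply pres_eq, Hun.
    intro j. apply pres_eq. rewrite <- !Hl, Hv, Hl, Hw. symmetry.
    apply Hx.
Qed.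

End LimitCriterion.

Definition arrows (J : category) : Type := {j : J & {k : J & @hom J j k}}.

Lemma finite_arrows (J : category) : finite_category J -> Finite (arrows J).
Proof.
intros [HJ H]. apply finite_sigma; [exact HJ|]. intro j.
now apply finite_sigma.
Qed.

Section ExplicitLimit.
Variables (C J : category) (D : functor J (Eh C)).
Let src (a : arrows J) : J := projT1 a.
Let tgt (a : arrows J) : J := projT1 (projT2 a).

(* A point of the limit consists of points [x j] and of homotopies, from the image
   of [x j] to [x k], for all arrows [j -> k]. *)
Definition base_system (r : forall j k : J, hom j k -> hom (e0 (D j)) (e0 (D k))) :
  system C :=
  @System C (J + arrows J) (arrows J + arrows J)
    (fun v => match v with inl j => e0 (D j) | inr a => e1 (D (tgt a)) end)
    (fun e => match e with inl a | inr a => e0 (D (tgt a)) end)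
    (fun e => match e with inl a => inl (src a) | inr a => inl (tgt a) end)
    (fun e => match e with inl a | inr a => inr a end)
    (fun e => match e with
       | inl a => r _ _ (projT2 (projT2 a)) | inr a => idm _ end)
    (fun e => match e with inl a => d0 _ | inr a => d1 _ end).

(** A solution is a pair of points of [x], indexed by [true] and [false], with a homotopy between
    their images in each [D j]. The universal one serves as [e1] of the limit. *)
Definition rel_system (x : C) (n : forall j, hom x (e0 (D j))) : system C :=
  @System C (bool + J) (J + J)
    (fun v => match v with inl _ => x | inr j => e1 (D j) end)
    (fun e => match e with inl j | inr j => e0 (D j) end)
    (fun e => match e with inl j => inl true | inr j => inl false end)
    (fun e => match e with inl j | inr j => inr j end)
    (fun e => match e with inl j | inr j => n j end)
    (fun e => match e with inl j => d0 _ | inr j => d1 _ end).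

Definition base_solution r (x : C) (n : forall j, hom x (e0 (D j)))
    (h : forall a, hom x (e1 (D (tgt a)))) :
  forall v : var (base_system r), hom x (var_ob v) :=
  fun v => match v with inl j => n j | inr a => h a end.

Definition rel_solution x n (y : C) (s t : hom y x)
    (h : forall j, hom y (e1 (D j))) :
  forall v : var (rel_system (x := x) n), hom y (var_ob v) :=
  fun v => match v with
    | inl true => s | inl false => t | inr j => h j end.

(** The limit is recorded through universal solutions in [C], because [universal_map] carries these
    along lex functors. *)
Definition explicit_limit (L : Eh C) (l : forall j, hom L (D j)) : Prop :=
  exists r n h k,
    (forall i j (u : hom i j), fmap D u ∘ pres _ = pres _ ∘ ι (r i j u)) /\
    (forall j, l j ∘ pres L = pres _ ∘ ι (n j)) /\
    universal (@base_solution r (e0 L) n h) /\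
    universal (@rel_solution (e0 L) n (e1 L) (d0 L) (d1 L) k).

Lemma explicit_is_limit (L : Eh C) (l : forall j, hom L (D j)) :
  explicit_limit l -> is_limit l.
Proof.
intros [r [n [h [k [Hr [Hn [[Hb Ub] [Hs Us]]]]]]]].
apply (limit_criterion Hr Hn).
- intros i j u. exists (h (existT _ i (existT _ j u))). split.
  + symmetry. exact (Hb (inl (existT _ i (existT _ j u)))).
  + rewrite <- (comp_idl (n j)). symmetry.
    exact (Hb (inr (existT _ i (existT _ j u)))).
- intros T x Hx.
  destruct (dependent_choice (fun a : arrows J => Hx _ _ (projT2 (projT2 a))))
    as [g Hg].
  destruct (Ub T (@base_solution r T x g)) as [w [Hw _]].
  + intros [a|a]; simpl; destruct (Hg a) as [g0 g1]; symmetry.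
    * exact g0.
    * rewrite comp_idl. exact g1.
  + exists w. intro j. exact (Hw (inl j)).
- intros T a b Hab.
  destruct (dependent_choice Hab) as [g Hg].
  destruct (Us T (@rel_solution (e0 L) n T a b g))
    as [w [Hw _]].
  + intros [j|j]; simpl; destruct (Hg j) as [g0 g1]; symmetry;
      [exact g0|exact g1].
  + exists w. split; [exact (Hw (inl true))|exact (Hw (inl false))].
Qed.

Lemma explicit_limit_exists :
  has_finite_limits C -> finite_category J ->
  exists (L : Eh C) (l : forall j, hom L (D j)), explicit_limit l.
Proof.
intros HC HJ. assert (HA := finite_arrows HJ).
destruct (dependent_choice (fun a : arrows J => hom_lift (fmap D (projT2 (projT2 a)))))
  as [r' R].
pose (r := fun i j (u : hom i j) => r' (existT _ i (existT _ j u))).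
destruct (universal_exists (S := base_system r) HC) as [x [p Hp]];
  [now apply finite_sum; [apply HJ|]|now apply finite_sum|].
pose (n := fun j => p (inl j)).
destruct (universal_exists (S := rel_system n) HC) as [y [q Hq]];
  [apply finite_sum; [exact finite_bool|apply HJ]|apply finite_sum; apply HJ|].
(* The relation on [x] is pulled back from equality of points in all [D j], which makes it an
   equivalence relation at once. *)
assert (rel : forall T (a b : hom T x),
  related (q (inl true)) (q (inl false)) a b <->
  forall j, pres _ ∘ ι (n j ∘ a) = pres _ ∘ ι (n j ∘ b)).
{ intros T a b. split.
  - intros [h [h0 h1]] j. apply pres_eq. exists (q (inr j) ∘ h). split.
    + rewrite comp_assoc, <- h0, comp_assoc. f_equal.
      symmetry. exact (proj1 Hq (inl j)).
    + rewrite comp_assoc, <- h1, comp_assoc. f_equal.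
      symmetry. exact (proj1 Hq (inr j)).
  - intro H.
    destruct (dependent_choice (fun j => proj1 (pres_eq _ _) (H j))) as [g Hg].
    destruct (proj2 Hq T (@rel_solution x n T a b g))
      as [w [Hw _]].
    + intros [j|j]; simpl; destruct (Hg j) as [g0 g1]; symmetry;
      [exact g0|exact g1].
    + exists w. split; [exact (Hw (inl true))|exact (Hw (inl false))]. }
unshelve epose (L := @eq2grpd_of_related C x y (q (inl true)) (q (inl false)) HC _ _ _).
- intros T f. now apply rel.
- intros T f g. rewrite !rel. auto.
- intros T f g h. rewrite !rel. intros H1 H2 j. now rewrite H1.
- assert (Hl : forall j, exists! l : hom (L : Eh C) (D j),
    l ∘ pres L = pres _ ∘ ι (n j)).
  { intro j. apply pres_coeq. rewrite <- !comp_assoc, <- !fmap_comp.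
    revert j. apply rel. exists (idm y). simpl. now rewrite !comp_idr. }
  destruct (dependent_choice Hl) as [l Ul].
  exists L, l, r, n, (fun a => p (inr a)),
    (fun j => q (inr j)).
  split; [|split; [|split]].
  + intros i j u. exact (R (existT _ i (existT _ j u))).
  + intro j. exact (proj1 (Ul j)).
  + replace (base_solution _ _) with p; [exact Hp|].
    apply functional_extensionality_dep. now intros [j|a].
  + replace (rel_solution _ _ _) with q; [exact Hq|].
    apply functional_extensionality_dep. now intros [[|]|j].
Qed.

End ExplicitLimit.

Lemma Eh_limits (C : category) : has_finite_limits C -> has_finite_limits (Eh C).
Proof.
intros HC J HJ D. destruct (explicit_limit_exists D HC HJ) as [L [l H]].
exists L, l. now apply explicit_is_limit.
Qed.

(** Both universal solutions are carried over by [universal_map]. The image of the base system has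
    [fmap F (idm _)] where the base system of the image has [idm _], so [limit_criterion] is applied
    anew instead of [explicit_is_limit]. *)
Lemma explicit_limit_map (C D : category) (F : lexfun C D) (J : category)
    (K : functor J (Eh C)) (L : Eh C) (l : forall j, hom L (K j)) :
  finite_category J -> explicit_limit l ->
  is_limit (D := functor_comp (Eh_map F) K) (fun j => fmap (Eh_map F) (l j)).
Proof.
intros HJ [r [n [h [k [Hr [Hn [Hb Hs]]]]]]]. assert (HA := finite_arrows HJ).
apply (@universal_map _ _ F) in Hb;
  [|now apply finite_sum; [apply HJ|]|now apply finite_sum|apply lex_preserves].
apply (@universal_map _ _ F) in Hs;
  [|apply finite_sum; [exact finite_bool|apply HJ]|apply finite_sum; apply HJ
   |apply lex_preserves].
apply (@limit_criterion D J (functor_comp (Eh_map F) K) (Eh_map F L) _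
  (fun i j u => fmap F (r i j u)) (fun j => fmap F (n j))).
- intros i j u. exact (Eh_map_lift F (Hr i j u)).
- intro j. exact (Eh_map_lift F (Hn j)).
- intros i j u. destruct Hb as [Hb _].
  exists (fmap F (h (existT _ i (existT _ j u)))). split.
  + symmetry. exact (Hb (inl (existT _ i (existT _ j u)))).
  + rewrite <- (comp_idl (fmap F (n j))), <- fmap_id. symmetry.
    exact (Hb (inr (existT _ i (existT _ j u)))).
- intros T x Hx.
  destruct (dependent_choice (fun a : arrows J => Hx _ _ (projT2 (projT2 a))))
    as [g Hg].
  destruct (proj2 Hb T (fun v => match v with
    | inl j => x j | inr a => g a end)) as [w [Hw _]].
  + intros [a|a]; simpl; destruct (Hg a) as [g0 g1]; symmetry.
    * exact g0.
    * rewrite fmap_id, comp_idl. exact g1.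
  + exists w. intro j. exact (Hw (inl j)).
- intros T a b Hab.
  destruct (dependent_choice Hab) as [g Hg].
  destruct (proj2 Hs T (fun v => match v with
    | inl true => a | inl false => b | inr j => g j end)) as [w [Hw _]].
  + intros [j|j]; simpl; destruct (Hg j) as [g0 g1]; symmetry;
      [exact g0|exact g1].
  + exists w. split; [exact (Hw (inl true))|exact (Hw (inl false))].
Qed.

Lemma limit_iso (J C : category) (D : functor J C) (x y : C)
    (l : forall j, hom x (D j)) (m : forall j, hom y (D j)) (w : hom x y) :
  is_iso w -> (forall j, m j ∘ w = l j) -> is_limit m -> is_limit l.
Proof.
intros [v [vw wv]] H [Hm U]. split.
- intros j k u. now rewrite <- !H, comp_assoc, Hm.
- intros z c Hc. destruct (U z c Hc) as [t [Ht Ut]]. exists (v ∘ t). split.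
  + intro j. now rewrite <- H, <- comp_assoc, (comp_assoc w), wv, comp_idl.
  + intros t' H'. rewrite (Ut (w ∘ t')).
    * now rewrite comp_assoc, vw, comp_idl.
    * intro j. now rewrite comp_assoc, H.
Qed.

Lemma limit_comparison (J C : category) (D : functor J C) (x y : C)
    (l : forall j, hom x (D j)) (m : forall j, hom y (D j)) :
  is_limit l -> is_limit m ->
  exists w : hom x y, is_iso w /\ forall j, m j ∘ w = l j.
Proof.
intros [Hl Ul] [Hm Um].
destruct (Um x l Hl) as [w [Hw _]], (Ul y m Hm) as [v [Hv _]].
exists w. split; [|exact Hw]. exists v. split.
- destruct (Ul x l Hl) as [t [_ U]]. transitivity t; [symmetry|]; apply U.
  + intro j. now rewrite comp_assoc, Hv.
  + intro j. apply comp_idr.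
- destruct (Um y m Hm) as [t [_ U]]. transitivity t; [symmetry|]; apply U.
  + intro j. now rewrite comp_assoc, Hw.
  + intro j. apply comp_idr.
Qed.

(** An arbitrary limit is isomorphic to an explicit one, whose image is a limit. *)
Lemma Eh_map_preserves (C D : category) (F : lexfun C D) :
  has_finite_limits C -> preserves_finite_limits (Eh_map F).
Proof.
intros HC J HJ K x l Hl.
destruct (explicit_limit_exists K HC HJ) as [L [m H]].
destruct (limit_comparison Hl (explicit_is_limit H)) as [w [Hw e]].
apply (@limit_iso J _ (functor_comp (Eh_map F) K) _ _ _
  (fun j => fmap (Eh_map F) (m j)) (fmap (Eh_map F) w)).
- now apply is_iso_fmap.
- intro j. rewrite <- e. symmetry. apply (fmap_comp (Eh_map F)).
- now apply explicit_limit_map.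
Qed.

(** * Quotients of equivalence 2-groupoids *)

Section Quotients.
Variable D : category.

(** Let [a] and [a'] lift [d] and [d']. A point of [x] is a point [z] of [e0 Y] with a homotopy [h]
    from the first point of [X] to [a ∘ z] and a homotopy [k] from [a' ∘ z] to the second. Such
    triples form a finite limit in [D]. *)
Lemma related_points (X Y : Eh D) (d d' : hom Y X) :
  has_finite_limits D ->
  exists (x : D) (s t : hom x (e0 X)), forall (T : D) (f g : hom T (e0 X)),
    related s t f g <-> related d d' (pres X ∘ ι f) (pres X ∘ ι g).
Proof.
intro HD.
destruct (hom_lift d) as [a Ha], (hom_lift d') as [a' Ha'].
assert (Hx : exists (x : D) (h k : hom x (e1 X)) (z : hom x (e0 Y)),
  d1 X ∘ h = a ∘ z /\ d0 X ∘ k = a' ∘ z /\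
  forall (T : D) (h' k' : hom T (e1 X)) (z' : hom T (e0 Y)),
    d1 X ∘ h' = a ∘ z' -> d0 X ∘ k' = a' ∘ z' ->
    exists w, h ∘ w = h' /\ k ∘ w = k' /\ z ∘ w = z').
{ destruct (@universal_exists D (@System D (bool + unit) bool
    (fun v => match v with inl _ => e1 X | inr _ => e0 Y end) (fun _ => e0 X)
    inl (fun _ => inr tt) (fun b => if b then d1 X else d0 X)
    (fun b => if b then a else a')) HD (finite_sum finite_bool finite_unit)
    finite_bool) as [x [p [E U]]].
  exists x, (p (inl true)), (p (inl false)), (p (inr tt)).
  split; [exact (E true)|split; [exact (E false)|]]. intros T h k z Eh Ek.
  destruct (U T (fun v => match v with
    | inl true => h | inl false => k | inr _ => z end)) as [w [Hw _]].
  - now intros [|].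
  - exists w. split; [exact (Hw (inl true))|].
    split; [exact (Hw (inl false))|exact (Hw (inr tt))]. }
destruct Hx as [x [h [k [z [Eh [Ek U]]]]]].
exists x, (d0 X ∘ h), (d1 X ∘ k). intros T f g. split.
- intros [w [<- <-]]. exists (pres Y ∘ ι (z ∘ w)).
  rewrite !comp_assoc, Ha, Ha', <- !comp_assoc, <- !fmap_comp.
  rewrite !(comp_assoc _ z), <- Eh, <- Ek. split.
  + symmetry. apply pres_eq. exists (h ∘ w). rewrite !comp_assoc; split; reflexivity.
  + apply pres_eq. exists (k ∘ w). rewrite !comp_assoc; split; reflexivity.
- intros [y [H0 H1]]. destruct (disc_lift y) as [z' ->].
  rewrite comp_assoc, Ha, <- comp_assoc, <- fmap_comp in H0.
  rewrite comp_assoc, Ha', <- comp_assoc, <- fmap_comp in H1.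
  symmetry in H0. apply pres_eq in H0, H1.
  destruct H0 as [h' [<- h1]], H1 as [k' [k0 <-]].
  destruct (U T h' k' z' h1 k0) as [w [w0 [w1 _]]].
  exists w. rewrite <- !comp_assoc, w0, w1; split; reflexivity.
Qed.

(* [q] exhibits [Q] as the quotient of [e0 A] by [A], seen from the objects of [D],
   which are projective in [Eh D]. *)
Definition is_quot (A : Eh (Eh D)) (Q : Eh D) (q : hom (e0 A) Q) : Prop :=
  (forall (T : D) (t : hom (Eh_emb D T) Q), exists s, t = q ∘ s) /\
  (forall (T : D) (s s' : hom (Eh_emb D T) (e0 A)),
     q ∘ s = q ∘ s' <-> pres A ∘ ι s = pres A ∘ ι s').

(** [Q] has the same [e0] as [e0 A], with points related when they become equal in [A].
    [related_points] represents this relation in [D], and it is an equivalence because it is pulled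
    back from an equality. The map [q] is the factorization of [pres Q] through [pres (e0 A)]. *)
Lemma quot_exists (A : Eh (Eh D)) :
  has_finite_limits D -> exists (Q : Eh D) (q : hom (e0 A) Q), is_quot q.
Proof.
intro HD. destruct (related_points (d0 A) (d1 A) HD) as [x [s [t H]]].
assert (rel : forall T (f g : hom T (e0 (e0 A))), related s t f g <->
  pres A ∘ ι (pres (e0 A) ∘ ι f) = pres A ∘ ι (pres (e0 A) ∘ ι g)).
{ intros T f g. rewrite H. symmetry. apply pres_eq. }
assert (R : forall T f, @related D _ _ s t T f f)
  by (intros; apply rel; reflexivity).
assert (S : forall T f g, @related D _ _ s t T f g -> related s t g f).
{ intros T f g E. apply rel. symmetry. apply rel, E. }
assert (Tr : forall T f g h, @related D _ _ s t T f g -> related s t g h ->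
  related s t f h).
{ intros T f g h E E'. apply rel.
  exact (eq_trans (proj1 (rel _ _ _) E) (proj1 (rel _ _ _) E')). }
pose (Q := eq2grpd_of_related HD R S Tr).
assert (relQ : forall T (f g : hom T (e0 (e0 A))),
  pres Q ∘ ι f = pres Q ∘ ι g <->
  pres A ∘ ι (pres (e0 A) ∘ ι f) = pres A ∘ ι (pres (e0 A) ∘ ι g)).
{ intros T f g. rewrite <- rel. apply (pres_eq (A := Q)). }
destruct (proj2 (pres_coeq (e0 A)) Q (pres Q)) as [q [Hq _]].
{ apply relQ. rewrite (proj1 (pres_coeq (e0 A))); reflexivity. }
exists Q, q. split.
- intros T u. destruct (disc_lift u) as [f ->]. exists (pres (e0 A) ∘ ι f).
  rewrite comp_assoc, Hq; reflexivity.
- intros T u v. destruct (disc_lift u) as [f ->], (disc_lift v) as [g ->].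
  rewrite <- relQ, !comp_assoc, Hq. reflexivity.
Qed.

(** [is_quot] speaks of points only; precomposing with [pres Y] reduces an arbitrary stage [Y] to
    points. *)
Lemma quot_eq (A : Eh (Eh D)) (Q : Eh D) (q : hom (e0 A) Q) (Y : Eh D)
    (s s' : hom Y (e0 A)) :
  is_quot q -> pres A ∘ ι s = pres A ∘ ι s' -> q ∘ s = q ∘ s'.
Proof.
intros [_ H] e. apply pres_epi. rewrite <- !comp_assoc. apply H.
rewrite !fmap_comp, !comp_assoc, e; reflexivity.
Qed.

(* A coequalizer that every [Eh_map F] preserves, since it is witnessed by
   equations between finitely many morphisms. *)
Definition split_quot (X Y Q : Eh D) (d d' : hom Y X) (q : hom X Q) : Prop :=
  q ∘ d = q ∘ d' /\
  exists (s : hom (Eh_emb D (e0 Q)) X) (y : hom (Eh_emb D (e1 Q)) Y)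
    (n : hom (e0 X) (e0 Q)) (z : hom (Eh_emb D (e0 X)) Y),
    q ∘ s = pres Q /\
    d ∘ y = s ∘ ι (d0 Q) /\ d' ∘ y = s ∘ ι (d1 Q) /\
    d ∘ z = s ∘ ι n /\ d' ∘ z = pres X.

(** Through [z], the maps [s ∘ ι n] and [pres X] are identified by any map coequalizing [d] and
    [d']. Such a map is thus determined by its restriction along [s], which descends to [Q] thanks
    to [y]. *)
Lemma split_quot_coeq (X Y Q : Eh D) (d d' : hom Y X) (q : hom X Q) :
  split_quot d d' q -> is_coeq d d' q.
Proof.
intros [E [s [y [n [z [qs [y0 [y1 [z0 z1]]]]]]]]]. split; [exact E|].
intros Z g Hg.
destruct (proj2 (pres_coeq Q) Z (g ∘ s)) as [k [Hk K]].
{ rewrite <- !comp_assoc, <- y0, <- y1, !comp_assoc, Hg; reflexivity. }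
exists k. split.
- apply pres_epi. rewrite <- z1, !comp_assoc, <- Hg, <- (comp_assoc k), <- E.
  rewrite <- !comp_assoc, z0, (comp_assoc q), qs, !comp_assoc, Hk. reflexivity.
- intros k' <-. apply K. rewrite <- comp_assoc, qs; reflexivity.
Qed.

(** [is_quot] is used at the projective stages [e0 Q], [e1 Q] and [e0 (e0 A)]: it lifts [pres Q] to
    [s], then turns equalities after [q] into points of [e1 A]. *)
Lemma quot_split (A : Eh (Eh D)) (Q : Eh D) (q : hom (e0 A) Q) :
  is_quot q -> split_quot (d0 A) (d1 A) q.
Proof.
intro H. split; [apply (quot_eq H), pres_coeq|].
destruct H as [Hs He].
destruct (Hs _ (pres Q)) as [s e].
assert (points : forall T (u v : hom (Eh_emb D T) (e0 A)), q ∘ u = q ∘ v ->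
  exists y, d0 A ∘ y = u /\ d1 A ∘ y = v).
{ intros T u v E. now apply pres_eq, He. }
destruct (hom_lift q) as [n Hn].
destruct (points _ (s ∘ ι (d0 Q)) (s ∘ ι (d1 Q))) as [y [y0 y1]].
{ rewrite !comp_assoc, <- e. apply pres_coeq. }
destruct (points _ (s ∘ ι n) (pres (e0 A))) as [z [z0 z1]].
{ rewrite comp_assoc, <- e, Hn; reflexivity. }
exists s, y, n, z. auto.
Qed.

End Quotients.

(** [Eh_map F] sends the image of [T] to the image of [F T] only up to [Eh_cmp], so witnesses with
    such a source are precomposed with that isomorphism. *)
Lemma split_quot_map (C D : category) (F : lexfun C D) (X Y Q : Eh C)
    (d d' : hom Y X) (q : hom X Q) :
  split_quot d d' q ->
  split_quot (fmap (Eh_map F) d) (fmap (Eh_map F) d') (fmap (Eh_map F) q).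
Proof.
intros [E [s [y [n [z [qs [y0 [y1 [z0 z1]]]]]]]]].
split; [rewrite <- !fmap_comp, E; reflexivity|].
assert (sq : forall (T T' : C) (e : hom Y X) (g : hom (Eh_emb C T) Y)
    (h : hom (Eh_emb C T') X) (u : hom T T'), e ∘ g = h ∘ ι u ->
  fmap (Eh_map F) e ∘ (fmap (Eh_map F) g ∘ Eh_cmp F T) =
  fmap (Eh_map F) h ∘ Eh_cmp F T' ∘ ι (fmap F u)).
{ intros T T' e g h u H. rewrite <- comp_assoc, <- Eh_cmp_natural.
  rewrite !comp_assoc, <- !fmap_comp, H. reflexivity. }
exists (fmap (Eh_map F) s ∘ Eh_cmp F _), (fmap (Eh_map F) y ∘ Eh_cmp F _),
  (fmap F n), (fmap (Eh_map F) z ∘ Eh_cmp F _).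
split; [|split; [|split; [|split]]].
- rewrite comp_assoc, <- fmap_comp, qs. apply Eh_map_pres.
- exact (sq _ _ _ _ _ _ y0).
- exact (sq _ _ _ _ _ _ y1).
- exact (sq _ _ _ _ _ _ z0).
- rewrite comp_assoc, <- fmap_comp, z1. apply Eh_map_pres.
Qed.

(** * The multiplication [mult] and its unit *)

Section Multiplication.
Variables (D : category) (HD : has_finite_limits D).

Definition mult_ob (A : Eh (Eh D)) : Eh D :=
  proj1_sig (constructive_indefinite_description _ (quot_exists A HD)).

Definition quot (A : Eh (Eh D)) : hom (e0 A) (mult_ob A) :=
  proj1_sig (constructive_indefinite_description _
    (proj2_sig (constructive_indefinite_description _ (quot_exists A HD)))).

Lemma quotP (A : Eh (Eh D)) : is_quot (quot A).
Proof.
exact (proj2_sig (constructive_indefinite_description _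
  (proj2_sig (constructive_indefinite_description _ (quot_exists A HD))))).
Qed.

Lemma quot_coeq (A : Eh (Eh D)) : is_coeq (d0 A) (d1 A) (quot A).
Proof. apply split_quot_coeq, quot_split, quotP. Qed.

Lemma quot_epi (A : Eh (Eh D)) (Z : Eh D) (f g : hom (mult_ob A) Z) :
  f ∘ quot A = g ∘ quot A -> f = g.
Proof. apply (coeq_epi (quot_coeq A)). Qed.

(** [k] has to fit every lift [f0], so that functoriality can use any lift. Two lifts agree after
    [pres B], hence after [quot B] by [quot_eq]. *)
Lemma mult_map_exists (A B : Eh (Eh D)) (f : hom A B) :
  exists k : hom (mult_ob A) (mult_ob B), forall f0 : hom (e0 A) (e0 B),
    f ∘ pres A = pres B ∘ ι f0 -> k ∘ quot A = quot B ∘ f0.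
Proof.
destruct (hom_lift f) as [f0 H0].
destruct (proj2 (quot_coeq A) _ (quot B ∘ f0)) as [k [Hk _]].
- rewrite <- !comp_assoc. apply (quot_eq (quotP B)).
  rewrite !fmap_comp, !comp_assoc, <- H0, <- !comp_assoc.
  rewrite (proj1 (pres_coeq A)). reflexivity.
- exists k. intros f1 H1. rewrite Hk. apply (quot_eq (quotP B)).
  exact (eq_trans (eq_sym H0) H1).
Qed.

Definition mult_map (A B : Eh (Eh D)) (f : hom A B) : hom (mult_ob A) (mult_ob B) :=
  proj1_sig (constructive_indefinite_description _ (mult_map_exists f)).

Lemma mult_mapE (A B : Eh (Eh D)) (f : hom A B) (f0 : hom (e0 A) (e0 B)) :
  f ∘ pres A = pres B ∘ ι f0 -> mult_map f ∘ quot A = quot B ∘ f0.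
Proof.
exact (proj2_sig (constructive_indefinite_description _ (mult_map_exists f)) f0).
Qed.

Definition mult : functor (Eh (Eh D)) (Eh D).
Proof.
refine (@Functor (Eh (Eh D)) (Eh D) mult_ob mult_map _ _).
- intro A. apply quot_epi. rewrite (mult_mapE (f0 := idm _)).
  + rewrite comp_idl, comp_idr; reflexivity.
  + rewrite fmap_id, comp_idl, comp_idr; reflexivity.
- intros A B E g f. apply quot_epi.
  destruct (hom_lift f) as [f0 Hf], (hom_lift g) as [g0 Hg].
  rewrite (mult_mapE (f0 := g0 ∘ f0)), <- comp_assoc, (mult_mapE Hf), !comp_assoc.
  + rewrite (mult_mapE Hg); reflexivity.
  + rewrite <- comp_assoc, Hf, comp_assoc, Hg, fmap_comp, comp_assoc; reflexivity.
Defined.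

(* Maps from an object [T] of [D] to [mult A] are the same as maps from the
   image of [T] in [Eh (Eh D)] to [A]. *)
Lemma mult_preserves : preserves_finite_limits mult.
Proof.
intros J HJ K L l [Hl univ].
destruct (dependent_choice (fun j => hom_lift (l j))) as [n Hn].
apply limit_disc.
{ intros i j u. rewrite <- (Hl i j u). symmetry. apply (fmap_comp mult). }
intros T m Hm.
(* The lifts [s j] of the [m j] are compatible only after [pres], which is what a cone in
   [Eh (Eh D)] requires. *)
destruct (dependent_choice (fun j => proj1 (quotP (K j)) T (m j))) as [s Hs].
destruct (univ (Eh_emb (Eh D) (Eh_emb D T)) (fun j => pres (K j) ∘ ι (s j)))
  as [w [Hw U]].
{ intros i j u. destruct (hom_lift (fmap K u)) as [u0 Hu].
  rewrite comp_assoc, Hu, <- comp_assoc, <- fmap_comp. apply quotP.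
  rewrite comp_assoc, <- (mult_mapE Hu), <- comp_assoc, <- Hs, <- Hs. apply Hm. }
destruct (disc_lift w) as [w0 ->].
assert (key : forall j (v : hom (Eh_emb D T) (e0 L)),
  mult_map (l j) ∘ (quot L ∘ v) = m j <->
  l j ∘ (pres L ∘ ι v) = pres (K j) ∘ ι (s j)).
{ intros j v.
  rewrite !comp_assoc, Hn, (mult_mapE (Hn j)), Hs, <- !comp_assoc, <- fmap_comp.
  apply quotP. }
exists (quot L ∘ w0). split.
- intro j. apply key, Hw.
- intros v Hv. destruct (proj1 (quotP L) T v) as [v0 ->]. apply quotP.
  apply U. intro j. apply key, Hv.
Qed.

Definition mult_unit (X : Eh D) : hom X (mult_ob (Eh_emb (Eh D) X)) :=
  quot (Eh_emb (Eh D) X).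

Lemma mult_unit_natural (X Y : Eh D) (f : hom X Y) :
  mult_map (ι f) ∘ mult_unit X = mult_unit Y ∘ f.
Proof.
apply (mult_mapE (A := Eh_emb (Eh D) X) (B := Eh_emb (Eh D) Y)).
rewrite !pres_disc, comp_idr, comp_idl. reflexivity.
Qed.

Lemma mult_map_pres (A : Eh (Eh D)) :
  mult_map (pres A) ∘ mult_unit (e0 A) = quot A.
Proof.
rewrite <- (comp_idr (quot A)). apply (mult_mapE (A := Eh_emb (Eh D) (e0 A))).
rewrite pres_disc, fmap_id; reflexivity.
Qed.

(** For the image of [X] both structure maps are identities, so [idm X] factors through the quotient
    map; this map is also epi, hence invertible. *)
Lemma mult_unit_iso (X : Eh D) : is_iso (mult_unit X).
Proof.
destruct (proj2 (quot_coeq (Eh_emb (Eh D) X)) X (idm X)) as [k [Hk _]];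
  [reflexivity|].
exists k. split; [exact Hk|]. apply quot_epi.
change (mult_unit X ∘ k ∘ mult_unit X = idm _ ∘ mult_unit X).
change (k ∘ mult_unit X = idm X) in Hk.
rewrite <- comp_assoc, Hk, comp_idl, comp_idr; reflexivity.
Qed.

End Multiplication.

(** * Left Kan extensions *)

(** Two left Kan extensions compare by mutually inverse 2-morphisms. This reduces each axiom on
    canonical 2-morphisms to [is_lan] for their target. *)
Lemma lan_desc_of_lan (B : bicategory) (X Y Z : B) (p : mor X Y) (f : mor X Z)
    (L : lan p f) (g : mor Y Z) (a : f ⇒ g ⊙ p) :
  is_lan a -> lan_desc_invertible L a.
Proof.
intro H.
destruct (lan_univ L a) as [b [Hb _]], (H L (lan_unit L)) as [b' [Hb' _]].
exists b. split; [exact Hb|]. exists b'. split.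
- destruct (lan_univ L (lan_unit L)) as [t [_ U]].
  transitivity t; [symmetry|]; apply U.
  + rewrite Hb' at 1. rewrite Hb, vcomp_assoc, <- hcomp_vcomp, vcomp_idl. reflexivity.
  + rewrite hcomp_id, vcomp_idl. reflexivity.
- destruct (H g a) as [t [_ U]]. transitivity t; [symmetry|]; apply U.
  + rewrite Hb at 1. rewrite Hb', vcomp_assoc, <- hcomp_vcomp, vcomp_idl. reflexivity.
  + rewrite hcomp_id, vcomp_idl. reflexivity.
Qed.

(** * Invertible 2-morphisms of [Lex] *)

Definition pointwise_iso (C D : category) (F G : functor C D) (a : nattrans F G) :
  Prop := forall x, is_iso (a x).

Lemma pointwise_iso_inv (C D : category) (F G : functor C D) (a : nattrans F G) :
  pointwise_iso a -> exists b : nattrans G F,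
    pointwise_iso b /\ nat_vcomp b a = nat_id F /\ nat_vcomp a b = nat_id G.
Proof.
intro H. destruct (dependent_choice H) as [b Hb].
assert (N : forall x y (u : hom x y), fmap F u ∘ b x = b y ∘ fmap G u).
{ intros x y u. destruct (Hb x) as [_ e], (Hb y) as [e' _].
  rewrite <- (comp_idr (fmap G u)), <- e, (comp_assoc (fmap G u)), natural.
  rewrite !comp_assoc, e', comp_idl. reflexivity. }
exists (@Nattrans C D G F b N). split; [|split].
- intro x. exists (a x). split; apply Hb.
- apply nattrans_ext. intro x. apply Hb.
- apply nattrans_ext. intro x. apply Hb.
Qed.

Lemma pointwise_iso_vcomp (C D : category) (F G H : functor C D)
    (b : nattrans G H) (a : nattrans F G) :
  pointwise_iso b -> pointwise_iso a -> pointwise_iso (nat_vcomp b a).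
Proof. intros Hb Ha x. apply is_iso_comp; auto. Qed.

Lemma pointwise_iso_hcomp (C D E : category) (G G' : functor D E)
    (F F' : functor C D) (b : nattrans G G') (a : nattrans F F') :
  pointwise_iso b -> pointwise_iso a -> pointwise_iso (nat_hcomp b a).
Proof. intros Hb Ha x. apply is_iso_comp; [|apply is_iso_fmap]; auto. Qed.

Lemma pointwise_iso_id (C D : category) (F : functor C D) : pointwise_iso (nat_id F).
Proof. intro x. apply is_iso_id. Qed.

Lemma invertible_pointwise (C D : Lex) (F G : mor C D) (a : F ⇒ G) :
  invertible a <-> pointwise_iso a.
Proof.
split.
- intros [b [e1 e2]] x. exists (ncomp b x). split.
  + exact (f_equal (fun c : nattrans F F => c x) e1).
  + exact (f_equal (fun c : nattrans G G => c x) e2).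
- intro H. destruct (pointwise_iso_inv H) as [b [_ e]]. exists b. exact e.
Qed.

(** * Presenting functors *)

Definition presenting (C E : category) (L : functor (Eh C) E) : Prop :=
  forall A : Eh C,
    is_coeq (fmap L (ι (d0 A))) (fmap L (ι (d1 A))) (fmap L (pres A)).

Lemma presenting_id (C : category) : presenting (functor_id (Eh C)).
Proof. intro A. apply pres_coeq. Qed.

Lemma presenting_iso (C E : category) (L L' : functor (Eh C) E) (a : nattrans L L') :
  pointwise_iso a -> presenting L -> presenting L'.
Proof.
intros Ha HL A. refine (coeq_iso (Ha _) (Ha _) (Ha _) _ _ _ (HL A)); apply natural.
Qed.

(** The isomorphisms [fmap L (c _)] identify the two forks. Below, [I] and [I'] are embeddings, [M]
    is [Eh_map F] and [c] is [Eh_cmp F]. *)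
Lemma coeq_square (A B C D E : category) (I : functor A C) (I' : functor B D)
    (F : functor A B) (M : functor C D) (L : functor D E)
    (c : forall x, hom (I' (F x)) (M (I x))) (x y : A) (X : C)
    (f g : hom y x) (p : hom (I x) X) (p' : hom (I' (F x)) (M X)) :
  (forall x y (u : hom x y), fmap M (fmap I u) ∘ c x = c y ∘ fmap I' (fmap F u)) ->
  (forall x, is_iso (c x)) -> fmap M p ∘ c x = p' ->
  is_coeq (fmap L (fmap I' (fmap F f))) (fmap L (fmap I' (fmap F g))) (fmap L p') ->
  is_coeq (fmap (functor_comp L M) (fmap I f)) (fmap (functor_comp L M) (fmap I g))
    (fmap (functor_comp L M) p).
Proof.
intros Nc Hc Hp HL.
assert (Hc' := fun x => is_iso_fmap L (Hc x)).
assert (N : forall u : hom y x,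
  fmap L (fmap M (fmap I u)) ∘ fmap L (c y) =
  fmap L (c x) ∘ fmap L (fmap I' (fmap F u))).
{ intro u. rewrite <- !fmap_comp, Nc. reflexivity. }
refine (coeq_iso (Hc' y) (Hc' x) (is_iso_id _) (N f) (N g) _ HL).
change (fmap L (fmap M p) ∘ fmap L (c x) = idm _ ∘ fmap L p').
rewrite comp_idl, <- Hp. symmetry. apply (fmap_comp L).
Qed.

Lemma presenting_map (C D E : category) (F : lexfun C D) (L : functor (Eh D) E) :
  presenting L -> presenting (functor_comp L (Eh_map F)).
Proof.
intros HL A.
exact (coeq_square (Eh_cmp_natural F) (Eh_cmp_iso F) (Eh_map_pres F A) (HL (Eh_map F A))).
Qed.

(** Up to [mult_unit], [mult] sends the presentation of [A] to the fork formed by [d0 A], [d1 A] and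
    [quot A]. *)
Lemma presenting_mult (D E : category) (HD : has_finite_limits D)
    (L : functor (Eh D) E) :
  (forall A : Eh (Eh D), is_coeq (fmap L (d0 A)) (fmap L (d1 A)) (fmap L (quot HD A))) ->
  presenting (functor_comp L (mult HD)).
Proof.
intros HL A.
assert (c := fun X => is_iso_fmap L (mult_unit_iso HD X)).
assert (N : forall (X Y : Eh D) (f : hom X Y),
  fmap L (mult_map HD (ι f)) ∘ fmap L (mult_unit HD X) =
  fmap L (mult_unit HD Y) ∘ fmap L f).
{ intros X Y f. rewrite <- !fmap_comp, mult_unit_natural. reflexivity. }
refine (coeq_iso (c (e1 A)) (c (e0 A)) (is_iso_id _) _ _ _ (HL A)).
- apply N.
- apply N.
- change (fmap L (mult_map HD (pres A)) ∘ fmap L (mult_unit HD (e0 A)) =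
    idm _ ∘ fmap L (quot HD A)).
  rewrite <- fmap_comp, mult_map_pres, comp_idl. reflexivity.
Qed.

(** The component at [A] is forced by the coequalizer [fmap L (pres A)]; naturality is checked after
    that epimorphism, on a lift of [f] to degree zero. *)
Lemma presenting_extend (C E : category) (L G : functor (Eh C) E)
    (w : nattrans (functor_comp L (Eh_emb C)) (functor_comp G (Eh_emb C))) :
  presenting L -> exists! b : nattrans L G, forall x, b (Eh_emb C x) = w x.
Proof.
intro HL.
assert (Hw : forall x y (f : hom x y),
  fmap G (ι f) ∘ w x = w y ∘ fmap L (ι f)) by (intros; apply (natural w)).
assert (Hb : forall A : Eh C, exists b : hom (L A) (G A),
  b ∘ fmap L (pres A) = fmap G (pres A) ∘ w (e0 A)).
{ intro A. destruct (proj2 (HL A) _ (fmap G (pres A) ∘ w (e0 A))) as [b [H _]].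
  - rewrite <- !comp_assoc, <- !Hw, !comp_assoc, <- !fmap_comp.
    rewrite (proj1 (pres_coeq A)). reflexivity.
  - exists b. exact H. }
destruct (dependent_choice Hb) as [b b_eq].
assert (N : forall A B (f : hom A B), fmap G f ∘ b A = b B ∘ fmap L f).
{ intros A B f. apply (coeq_epi (HL A)). destruct (hom_lift f) as [f0 Hf].
  rewrite <- !comp_assoc, b_eq, <- (fmap_comp L), Hf, fmap_comp, comp_assoc.
  rewrite <- (fmap_comp G), Hf, fmap_comp, <- comp_assoc, Hw, !comp_assoc, b_eq.
  reflexivity. }
exists (@Nattrans (Eh C) E L G b N). split.
- intro x. assert (e := b_eq (Eh_emb C x)). rewrite pres_disc, !fmap_id in e.
  rewrite comp_idr, comp_idl in e. exact e.
- intros b' Hb'. apply nattrans_ext. intro A. simpl. apply (coeq_epi (HL A)).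
  rewrite b_eq, <- (natural b'), Hb'. reflexivity.
Qed.

(** * Left Kan extensions along the embedding, in [Lex] *)

Definition Eh_lex (C : lexcat) : lexcat := LexCat (Eh_limits (@lex_limits C)).

Definition Eh_emb_lex (C : lexcat) : lexfun C (Eh_lex C) :=
  LexFun (@Eh_emb_preserves C).

Definition Eh_map_lex (C D : lexcat) (F : lexfun C D) : lexfun (Eh_lex C) (Eh_lex D) :=
  LexFun (Eh_map_preserves F (@lex_limits C)).

Definition mult_lex (C : lexcat) : lexfun (Eh_lex (Eh_lex C)) (Eh_lex C) :=
  LexFun (mult_preserves (@lex_limits C)).

(** Composing [a] with the inverse of [u] gives a transformation between restrictions to [C], which
    [presenting_extend] extends uniquely. *)
Lemma presenting_is_lan (C E : lexcat) (F : lexfun C E) (L : lexfun (Eh_lex C) E)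
    (u : nattrans F (functor_comp L (Eh_emb C))) :
  pointwise_iso u -> presenting L ->
  @is_lan Lex C (Eh_lex C) E (Eh_emb_lex C) F L u.
Proof.
intros Hu HL G a. change (nattrans F (functor_comp G (Eh_emb C))) in a.
destruct (pointwise_iso_inv Hu) as [v [_ [vu uv]]].
destruct (presenting_extend (nat_vcomp a v) HL) as [b [Hb U]].
exists b. split.
- apply nattrans_ext. intro x.
  assert (e : v x ∘ u x = idm _)
    by exact (f_equal (fun c : nattrans F F => c x) vu).
  (* Whiskering through [nat_hcomp] leaves the factor [fmap L (idm _)]. *)
  change (a x = b (Eh_emb C x) ∘ fmap L (idm _) ∘ u x).
  rewrite fmap_id, comp_idr, Hb. change (a x = a x ∘ v x ∘ u x).
  rewrite <- comp_assoc, e, comp_idr. reflexivity.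
- intros b' ->. apply U. intro x.
  assert (e : u x ∘ v x = idm _)
    by exact (f_equal (fun c : nattrans _ _ => c x) uv).
  change (b' (Eh_emb C x) = b' (Eh_emb C x) ∘ fmap L (idm _) ∘ u x ∘ v x).
  rewrite fmap_id, comp_idr.
  transitivity (b' (Eh_emb C x) ∘ (u x ∘ v x)); [|apply comp_assoc].
  rewrite e. symmetry. apply comp_idr.
Qed.

Lemma pointwise_iso_asc (A B C D : category) (H : functor C D) (G : functor B C)
    (F : functor A B) : pointwise_iso (nat_asc H G F).
Proof. intro x. apply is_iso_id. Qed.

Lemma pointwise_iso_asc_inv (A B C D : category) (H : functor C D)
    (G : functor B C) (F : functor A B) : pointwise_iso (nat_asc_inv H G F).
Proof. intro x. apply is_iso_id. Qed.

Lemma pointwise_iso_lun (C D : category) (F : functor C D) :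
  pointwise_iso (nat_lun F).
Proof. intro x. apply is_iso_id. Qed.

Lemma pointwise_iso_lun_inv (C D : category) (F : functor C D) :
  pointwise_iso (nat_lun_inv F).
Proof. intro x. apply is_iso_id. Qed.

Lemma pointwise_iso_run (C D : category) (F : functor C D) :
  pointwise_iso (nat_run F).
Proof. intro x. apply is_iso_id. Qed.

Lemma pointwise_iso_run_inv (C D : category) (F : functor C D) :
  pointwise_iso (nat_run_inv F).
Proof. intro x. apply is_iso_id. Qed.

(** Canonical 2-morphisms are pastings of structural isomorphisms with units or given
    transformations; only goals about the latter remain. Matching is syntactic, so cells are listed
    both as cells of [Lex] and as natural transformations. *)
Ltac solve_iso := repeat lazymatch goal with
  | |- pointwise_iso (nat_vcomp _ _) => apply pointwise_iso_vcomp
  | |- pointwise_iso (vcomp _ _) => apply pointwise_iso_vcomp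
  | |- pointwise_iso (nat_hcomp _ _) => apply pointwise_iso_hcomp
  | |- pointwise_iso (hcomp _ _) => apply pointwise_iso_hcomp
  | |- pointwise_iso (nat_id _) => apply pointwise_iso_id
  | |- pointwise_iso (cid _) => apply pointwise_iso_id
  | |- pointwise_iso (nat_asc _ _ _) => apply pointwise_iso_asc
  | |- pointwise_iso (asc _ _ _) => apply pointwise_iso_asc
  | |- pointwise_iso (nat_asc_inv _ _ _) => apply pointwise_iso_asc_inv
  | |- pointwise_iso (asc_inv _ _ _) => apply pointwise_iso_asc_inv
  | |- pointwise_iso (nat_lun_inv _) => apply pointwise_iso_lun_inv
  | |- pointwise_iso (lun_inv _) => apply pointwise_iso_lun_inv
  | |- pointwise_iso (run _) => apply pointwise_iso_run
  | |- pointwise_iso (run_inv _) => apply pointwise_iso_run_inv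
  end.

(** The comparison of the known extension [L] with an arbitrary one [K] is invertible, which
    transfers to [K] what the axioms need. *)
Lemma lan_comparison (C E : lexcat) (F : lexfun C E) (L : lexfun (Eh_lex C) E)
    (u : nattrans F (functor_comp L (Eh_emb C)))
    (K : @lan Lex C (Eh_lex C) E (Eh_emb_lex C) F) :
  pointwise_iso u -> presenting L ->
  (exists b : nattrans L (lan_mor K : lexfun (Eh_lex C) E), pointwise_iso b) /\
  presenting (lan_mor K : lexfun (Eh_lex C) E) /\ pointwise_iso (lan_unit K).
Proof.
intros Hu HL.
destruct (lan_desc_of_lan (Lan (presenting_is_lan Hu HL)) (lan_univ K))
  as [b [e Hb]].
apply (invertible_pointwise (C := Eh_lex C) (D := E)) in Hb.
split; [exists b; exact Hb|]. split; [exact (presenting_iso Hb HL)|].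
rewrite e. solve_iso; assumption.
Qed.

Lemma presenting_Eh_map (C D : category) (F : lexfun C D) : presenting (Eh_map F).
Proof.
apply (presenting_iso (@pointwise_iso_lun _ _ (Eh_map F))).
apply presenting_map, presenting_id.
Qed.

Lemma presenting_mult_id (D : category) (HD : has_finite_limits D) :
  presenting (mult HD).
Proof.
apply (presenting_iso (@pointwise_iso_lun _ _ (mult HD))).
apply presenting_mult. intro A. apply quot_coeq.
Qed.

Definition mult_unit_nat (D : category) (HD : has_finite_limits D) :
  nattrans (functor_id (Eh D)) (functor_comp (mult HD) (Eh_emb (Eh D))) :=
  @Nattrans (Eh D) (Eh D) (functor_id (Eh D))
    (functor_comp (mult HD) (Eh_emb (Eh D)))
    (mult_unit HD) (mult_unit_natural HD).

(** * Extension of lex functors with values in [Eh D] *)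

Section Extension.
Variables (C D : lexcat) (F : lexfun C (Eh_lex D)).

Definition extension : lexfun (Eh_lex C) (Eh_lex D) :=
  lexfun_comp (mult_lex D) (Eh_map_lex F).

(** The composite of [F -> mult ∘ Eh_emb ∘ F], from the unit of [mult], and [mult ∘ Eh_emb ∘ F ->
    mult ∘ Eh_map F ∘ Eh_emb], from [Eh_emb_map]; the other cells are structural. *)
Definition extension_unit : nattrans F (functor_comp extension (Eh_emb C)) :=
  nat_vcomp (nat_asc (mult_lex D) (Eh_map F) (Eh_emb C))
    (nat_vcomp (nat_hcomp (nat_id (mult_lex D)) (Eh_emb_map F))
      (nat_vcomp (nat_asc_inv (mult_lex D) (Eh_emb (Eh_lex D)) F)
        (nat_vcomp (nat_hcomp (mult_unit_nat (@lex_limits D)) (nat_id F))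
          (nat_lun_inv F)))).

Lemma extension_unit_iso : pointwise_iso extension_unit.
Proof.
unfold extension_unit. solve_iso.
- exact (Eh_cmp_iso F).
- exact (mult_unit_iso (@lex_limits D)).
Qed.

End Extension.

Lemma presenting_extension (C D : lexcat) (F : lexfun C (Eh_lex D)) :
  presenting (extension F).
Proof.
apply (@presenting_map C (Eh D) (Eh D) F).
apply presenting_mult_id.
Qed.

Lemma lan_extension (C D : lexcat) (F : lexfun C (Eh_lex D))
    (K : @lan Lex C (Eh_lex C) (Eh_lex D) (Eh_emb_lex C) F) :
  (exists b : nattrans (extension F) (lan_mor K : lexfun (Eh_lex C) (Eh_lex D)),
     pointwise_iso b) /\
  presenting (lan_mor K : lexfun (Eh_lex C) (Eh_lex D)) /\
  pointwise_iso (lan_unit K).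
Proof. exact (lan_comparison K (@extension_unit_iso C D F) (presenting_extension F)). Qed.

Lemma lan_Eh_map (C D : lexcat) (F : lexfun C D)
    (K : @lan Lex C (Eh_lex C) (Eh_lex D) (Eh_emb_lex C)
      (lexfun_comp (Eh_emb_lex D) F)) :
  (exists b : nattrans (Eh_map F) (lan_mor K : lexfun (Eh_lex C) (Eh_lex D)),
     pointwise_iso b) /\
  presenting (lan_mor K : lexfun (Eh_lex C) (Eh_lex D)) /\
  pointwise_iso (lan_unit K).
Proof.
exact (@lan_comparison C (Eh_lex D) (lexfun_comp (Eh_emb_lex D) F) (Eh_map_lex F)
  (Eh_emb_map F) K (Eh_cmp_iso F) (presenting_Eh_map F)).
Qed.

(** * The axioms of a KZ-doctrine *)

Definition Eh_kz_data : kz_data Lex :=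
  Eh_kz (fun C : lexcat => Eh_limits (@lex_limits C))
    (fun C : lexcat => @Eh_emb_preserves C).

Lemma presenting_comp_lan (C D E : lexcat) (F : lexfun C D)
    (K : @lan Lex C (Eh_lex C) (Eh_lex D) (Eh_emb_lex C)
      (lexfun_comp (Eh_emb_lex D) F)) (L : lexfun (Eh_lex D) E) :
  presenting L ->
  presenting (functor_comp L (lan_mor K : lexfun (Eh_lex C) (Eh_lex D))).
Proof.
intro HL. destruct (lan_Eh_map K) as [[b Hb] _].
apply (@presenting_iso C E _ _ (nat_hcomp (nat_id L) b));
  [solve_iso; exact Hb|exact (presenting_map F HL)].
Qed.

Lemma Eh_kz_machine : is_kz_machine Eh_kz_data.
Proof.
split; [|split].
- intros C D F. unshelve eexists (Lan _); [exact (Eh_map_lex F)|exact (Eh_emb_map F)| |].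
  + exact (@presenting_is_lan C (Eh_lex D) (lexfun_comp (Eh_emb_lex D) F)
      (Eh_map_lex F) (Eh_emb_map F) (Eh_cmp_iso F) (presenting_Eh_map F)).
  + apply (invertible_pointwise (C := C) (D := Eh_lex D)). exact (Eh_cmp_iso F).
- intros C D E G F Pg Pf Pgf. apply lan_desc_of_lan.
  apply (@presenting_is_lan C (Eh_lex E)
    (lexfun_comp (Eh_emb_lex E) (lexfun_comp G F))
    (lexfun_comp (lan_mor Pg) (lan_mor Pf))).
  + solve_iso; [apply (lan_Eh_map Pf)|apply (lan_Eh_map Pg)].
  + apply (@presenting_comp_lan C D (Eh_lex E) F Pf), lan_Eh_map.
- intros C Pid. apply lan_desc_of_lan.
  apply (@presenting_is_lan C (Eh_lex C)
    (lexfun_comp (Eh_emb_lex C) (lexfun_id C)) (lexfun_id (Eh_lex C))).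
  + solve_iso.
  + apply presenting_id.
Qed.

Lemma Eh_cocomplete (D : lexcat) : kz_cocomplete Eh_kz_data (Eh_lex D).
Proof.
split.
- intros C F. unshelve eexists (Lan _); [exact (extension F)|exact (extension_unit F)| |].
  + exact (presenting_is_lan (@extension_unit_iso C D F) (presenting_extension F)).
  + apply (invertible_pointwise (C := C) (D := Eh_lex D)).
    exact (@extension_unit_iso C D F).
- intros B C G F Pg Lf Lfg. apply lan_desc_of_lan.
  apply (@presenting_is_lan B (Eh_lex D) (lexfun_comp F G)
    (lexfun_comp (lan_mor Lf) (lan_mor Pg))).
  + solve_iso; [apply (lan_Eh_map Pg)|apply (lan_extension Lf)].
  + apply (@presenting_comp_lan B C (Eh_lex D) G Pg), (lan_extension Lf).
Qed.

(** The composite of [K] with [m] is isomorphic to [Eh_map F] after [mult]. By [presenting_mult] it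
    is presenting once [Eh_map F] preserves the coequalizers [quot A], and it does because they are
    split in the sense of [split_quot]. *)
Lemma Eh_linear (C D : lexcat) (F : lexfun C D)
    (K : kz_lan Eh_kz_data (X := C) (Y := D) F) :
  kz_linear Eh_kz_data (X := Eh_lex C) (Y := Eh_lex D) K.
Proof.
intros m Lf. apply lan_desc_of_lan.
destruct (@lan_comparison (Eh_lex C) (Eh_lex C) (lexfun_id (Eh_lex C)) (mult_lex C)
  (mult_unit_nat (@lex_limits C)) m (mult_unit_iso (@lex_limits C))
  (presenting_mult_id (@lex_limits C))) as [[b Hb] [_ Hm]].
apply (@presenting_is_lan (Eh_lex C) (Eh_lex D) (lan_mor K)
  (lexfun_comp (lan_mor K) (lan_mor m))).
- solve_iso. exact Hm.
- destruct (lan_Eh_map K) as [[c Hc] _].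
  apply (@presenting_iso (Eh C) (Eh D) (functor_comp (Eh_map F) (mult (@lex_limits C)))
    _ (nat_hcomp c b)); [solve_iso; assumption|].
  apply presenting_mult. intro A.
  apply split_quot_coeq, split_quot_map, quot_split, quotP.
Qed.

Theorem theorem1 :
  exists (HE : forall C : lexcat, has_finite_limits (Eh C))
         (Hi : forall C : lexcat, preserves_finite_limits (Eh_emb C))
         (HF : forall (C D : lexcat) (F : lexfun C D),
                 preserves_finite_limits (Eh_map F)),
    (forall C : lexcat, fully_faithful (Eh_emb C)) /\
    (forall (C D : lexcat) (F : lexfun C D),
       @is_lan Lex C (LexCat (HE C)) (LexCat (HE D))
         (LexFun (Hi C)) (lexfun_comp (LexFun (Hi D)) F)
         (LexFun (HF C D F)) (Eh_emb_map F)) /\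
    is_kz_doctrine (Eh_kz HE Hi).
Proof.
exists (fun C : lexcat => Eh_limits (@lex_limits C)),
  (fun C : lexcat => @Eh_emb_preserves C),
  (fun C D F => Eh_map_preserves F (@lex_limits C)).
split; [intro C; apply Eh_emb_fully_faithful|]. split; [|split; [|split]].
- intros C D F.
  exact (@presenting_is_lan C (Eh_lex D) (lexfun_comp (Eh_emb_lex D) F)
    (Eh_map_lex F) (Eh_emb_map F) (Eh_cmp_iso F) (presenting_Eh_map F)).
- exact Eh_kz_machine.
- exact Eh_cocomplete.
- exact Eh_linear.
Qed.
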